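(* Assume the framework described in the context: the data $X,b,B,U,C,f,g,F$, assumptions (A1)–(A4) with a telescopic sequence $(S_k)_{k=1}^\infty$ and strong convexity parameters $(\mu_k)_{k=1}^\infty$, a sequence $(x_k)_{k=1}^\infty$ with associated parameters $(L_k)_{k=1}^\infty$ generated by either Algorithm A or Algorithm B, and a nondecreasing sequence $(\tau_k)_{k=1}^\infty$ of positive numbers with $L_k\le\tau_k$ for all $k\in\mathbb{N}$. Then the following hold. (1) For each minimizer $x_{\min}\in \mathrm{MIN}(F)$ there exists $k_0\in\mathbb{N}$ (which satisfies $k_0\ge 2$ if $F(x_1)=\infty$) such that for each $k\ge k_0$, $$F(x_{k+1})-F(x_{\min})\le \frac{\tau_{k+1}\,B(x_{\min},x_{k_0})}{(k+1-k_0)\,\mu_{k+1}}.$$ (2) If, in addition, $$\lim_{k\to\infty}\frac{\tau_k}{k\mu_k}=0, \qquad ( * )$$ then $\lim_{k\to\infty}F(x_k)=\inf\{F(x):x\in C\}$. (3) If $( * )$ holds, $B$ has the limiting difference property and all of the first type level-sets of $B$ are bounded, then there exists $z_\infty\in\mathrm{MIN}(F)$ such that $(x_k)_{k=1}^\infty$ converges weakly to $z_\infty$. (4) In particular, if $( * )$ holds, $b'$ is weak-to-weak$^*$ sequentially continuous on $U$, and either $U$ is bounded or for each $x\in C$ there exists $r_x\ge 0$ such that $\{y\in U:\|y\|\ge r_x\}\ne\emptyset$ and $b$ is uniformly convex relative to $(\{x\},\{y\in U:\|y\|\ge r_x\})$ with a gauge $\psi_x$ satisfying $\lim_{t\to\infty}\psi_x(t)=\infty$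 (this latter condition holds, in particular, if $b$ is uniformly convex on $U$), then $(x_k)_{k=1}^\infty$ converges weakly to some point in $\mathrm{MIN}(F)$.
   Context: **Space and Bregman function.** $(X,\|\cdot\|)$, $X\neq\{0\}$, is a real reflexive Banach space with dual $X^*$, and $\langle x^*,x\rangle:=x^*(x)$. The function $b:X\to(-\infty,\infty]$ is a semi-Bregman function with zone $U$, i.e. $U=\mathrm{Int}(\mathrm{dom}(b))\neq\emptyset$, $b$ is Gâteaux differentiable in $U$ (with gradient $b'$), $b$ is convex and lower semicontinuous on $X$ and strictly convex on $\mathrm{dom}(b)=\{x:b(x)<\infty\}$. Its Bregman divergence is $B(x,y):=b(x)-b(y)-\langle b'(y),x-y\rangle$ for $(x,y)\in\mathrm{dom}(b)\times U$ and $B(x,y):=\infty$ otherwise. **Properties of $b$, $B$.** $B$ has the limiting difference property if for each $x\in\mathrm{dom}(b)$ and each sequence $(y_i)$ in $U$ converging weakly to some $y\in U$, $B(x,y)=\lim_{i\to\infty}(B(x,y_i)-B(y,y_i))$. The first type level-sets of $B$ are $\{y\in U:B(x,y)\le\gamma\}$, for $x\in\mathrm{dom}(b)$ and $\gamma\in[0,\infty)$. $b'$ is weak-to-weak$^*$ sequentially continuous on $U$ if whenever $x_i\in U$ converge weakly to $x\in U$, $\lim_i\langle b'(x_i),w\rangle=\langle b'(x),w\rangle$ for all $w\in X$. **Convexity notions.** For nonempty $S_1',S_2'\subseteq\mathrm{dom}(b)$, $b$ is uniformly convex relative to $(S_1',S_2')$ with (relative) gauge $\psi:[0,\infty)\to[0,\infty]$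 if $\psi(t)>0$ for $t>0$ and $b(\lambda x+(1-\lambda)y)+\lambda(1-\lambda)\psi(\|x-y\|)\le\lambda b(x)+(1-\lambda)b(y)$ for all $\lambda\in(0,1)$, $(x,y)\in S_1'\times S_2'$. It is uniformly convex on $S$ if it is so relative to $(S,S)$ with some gauge, and strongly convex on $S$ with parameter $\mu>0$ if it is so with the gauge $\psi(t)=\frac12\mu t^2$. **The problem.** $C\subseteq\mathrm{dom}(b)$ is nonempty, closed and convex, contains more than one point, and $C\cap U\ne\emptyset$. $f:\mathrm{dom}(b)\to\mathbb{R}$ is convex on $\mathrm{dom}(b)$, Gâteaux differentiable in $U$ (derivative $f'$), and its restriction to $C$ is lower semicontinuous. $g:C\to(-\infty,\infty]$ is convex, proper and lower semicontinuous. $F:X\to(-\infty,\infty]$ is $F(x):=f(x)+g(x)$ for $x\in C$ and $F(x):=\infty$ for $x\notin C$. $\mathrm{MIN}(F):=\{x\in C:F(x)=\inf_C F\}$. **Proximal operation.** For $L>0$, $\mu>0$ and a closed convex $S\subseteq C$ such that $S\cap U\neq\emptyset$, $g$ is proper on $S$, and $b$ is strongly convex on $S$ with parameter $\mu$, put, for $x\in S$ and $y\in U$, $$Q_{L,\mu,S}(x,y):=f(y)+\langle f'(y),x-y\rangle+\frac{L}{\mu}B(x,y)+g(x),$$ and for $y\in S\cap U$ let $p_{L,\mu,S}(y)$ be the minimizer of $x\mapsto Q_{L,\mu,S}(x,y)$ over $S$ (it exists and is unique). **Assumptions.** (A1) $\mathrm{MIN}(F)$ is nonempty and contained in $U$.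 (A2) $(S_k)_{k=1}^\infty$ is a telescopic sequence: for each $k$, $S_k$ is closed and convex, $S_k\cap U$ contains more than one point, $S_k\subseteq S_{k+1}\subseteq C$, $b$ is strongly convex on $S_k$ with parameter $\mu_k>0$, $\mu_{k+1}\le\mu_k$; moreover $\bigcup_{k}S_k=C$ and $g$ is proper on $S_1$. (A3) For each $k$, $f'$ is Lipschitz continuous on $S_k\cap U$, with smallest Lipschitz constant $L(f',S_k\cap U)$. (A4) For all $L>0$, $k\in\mathbb{N}$ and $y\in S_k\cap U$, $p_{L,\mu_k,S_k}(y)\in S_k\cap U$. **Algorithm A (Lipschitz step size rule).** Input: $L_1>0$ with $L_1\ge L(f',S_1\cap U)$. Step 1: $x_1\in S_1\cap U$ arbitrary. Step $k\ge2$: $L_k$ is arbitrary with $L_k\ge\max\{L_{k-1},L(f',S_k\cap U)\}$, and $x_k:=p_{L_k,\mu_k,S_k}(x_{k-1})$. **Algorithm B (backtracking step size rule).** Input: $\eta>1$, and $L_1$, which is an arbitrary positive number if $S_k=C$ for all $k$, and otherwise is any number satisfying $0<L_1\le\eta L(f',S_1\cap U)$. Step 1: $x_1\in S_1\cap U$ arbitrary. Step $k\ge2$: let $i_k$ be the smallest nonnegative integer such that with $L_k:=\eta^{i_k}L_{k-1}$ one has $F(p_{L_k,\mu_k,S_k}(x_{k-1}))\le Q_{L_k,\mu_k,S_k}(p_{L_k,\mu_k,S_k}(x_{k-1}),x_{k-1})$, and set $x_k:=p_{L_k,\mu_k,S_k}(x_{k-1})$ (such $i_k$ exists). *)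

(* Defs.v *)
From HB Require Import structures.
From mathcomp Require Import all_boot all_order all_algebra.
From mathcomp Require Import all_classical all_reals all_analysis.

Set Implicit Arguments.
Unset Strict Implicit.
Unset Printing Implicit Defensive.

Import Order.TTheory GRing.Theory Num.Theory.
Import numFieldNormedType.Exports.

Local Open Scope classical_set_scope.
Local Open Scope ring_scope.

Section banach_space.
Context {R : realType} {X : completeNormedModType R}.

Definition dual (l : X -> R) : Prop := scalar l /\ continuous l.

Definition dual_norm (l : X -> R) : \bar R :=
  ereal_sup [set `|l v|%:E | v in [set v : X | `|v| <= 1]].

Definition weak_cvg (y : nat -> X) (z : X) : Prop :=
  forall l, dual l -> l (y i) @[i --> \oo] --> l z.

Definition gateaux_differentiable (h : X -> R) (y : X) : Prop :=
  (forall v, derivable (h : X -> R^o) y v) /\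
  dual (fun v => 'D_v (h : X -> R^o) y).

Definition grad (h : X -> R) (y v : X) : R := 'D_v (h : X -> R^o) y.

Definition lipschitz_grad_with (h : X -> R) (A : set X) (c : R) : Prop :=
  0 <= c /\ forall x y, A x -> A y ->
    (dual_norm (fun v => (grad h x v - grad h y v)%R) <= (c * `|x - y|)%:E)%E.

Definition lipschitz_grad (h : X -> R) (A : set X) : Prop :=
  exists c, lipschitz_grad_with h A c.

(* The infimum is attained when [lipschitz_grad h A] holds, and is the junk
   value 0 otherwise. *)
Definition lip_const (h : X -> R) (A : set X) : R :=
  inf [set c | lipschitz_grad_with h A c].

Definition more_than_one_point (A : set X) : Prop :=
  exists x y, [/\ A x, A y & x <> y].

Definition proper_on (A : set X) (h : X -> \bar R) : Prop :=
  (forall x, A x -> (-oo < h x)%E) /\ exists2 x, A x & (h x < +oo)%E.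

Definition econvex_on (A : set X) (h : X -> \bar R) : Prop :=
  forall x y (t : R), A x -> A y -> 0 < t -> t < 1 ->
    (h (t *: x + (1 - t) *: y)%R <= t%:E * h x + (1 - t)%:E * h y)%E.

Definition strictly_econvex_on (A : set X) (h : X -> \bar R) : Prop :=
  forall x y (t : R), A x -> A y -> x <> y -> 0 < t -> t < 1 ->
    (h (t *: x + (1 - t) *: y)%R < t%:E * h x + (1 - t)%:E * h y)%E.

(* The topology of [subspace A] is the relative topology at the points of A
   and is discrete elsewhere, so values outside A do not matter. *)
Definition lsc_on (A : set X) (h : X -> \bar R) : Prop :=
  @lower_semicontinuous (subspace A) R h.

End banach_space.

(* Phi ranges over all functions on X -> R but is only constrained on, and only
   compared with an evaluation on, the dual: it stands for an element of the
   bidual, extended arbitrarily. *)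
Definition reflexive_space (R : realType) (X : completeNormedModType R) : Prop :=
  forall Phi : (X -> R) -> R,
    (forall (a : R) (l m : X -> R), dual l -> dual m ->
       Phi (fun v => a * l v + m v) = a * Phi l + Phi m) ->
    (exists M : R, forall l : X -> R, dual l ->
       (`|Phi l|%:E <= M%:E * dual_norm l)%E) ->
    exists x : X, forall l : X -> R, dual l -> Phi l = l x.

Section bregman.
Context {R : realType} {X : completeNormedModType R}.
Variables (b : X -> \bar R) (U : set X).

Definition edom : set X := [set x | (b x < +oo)%E].

(* [fine \o b] agrees with b near every point of the zone, so its directional
   derivatives there are those of b. *)
Definition egrad (y v : X) : R := grad (fine \o b) y v.

Definition semi_bregman : Prop :=
  [/\ [/\ U = interior edom, U !=set0 & forall x, (-oo < b x)%E],
      forall y, U y -> gateaux_differentiable (fine \o b) y,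
      econvex_on setT b,
      lower_semicontinuous b
    & strictly_econvex_on edom b].

Definition divergence (x y : X) : \bar R :=
  if (x \in edom) && (y \in U)
  then (b x - b y - (egrad y (x - y)%R)%:E)%E
  else +oo%E.

Definition limiting_difference : Prop :=
  forall (x : X) (y_ : nat -> X) (y : X),
    edom x -> (forall i, U (y_ i)) -> U y -> weak_cvg y_ y ->
    (divergence x (y_ i) - divergence y (y_ i))%E @[i --> \oo]
      --> divergence x y.

Definition first_level_sets_bounded : Prop :=
  forall (x : X) (gamma : R), edom x -> 0 <= gamma ->
    bounded_set [set y | U y /\ (divergence x y <= gamma%:E)%E].

Definition grad_weak_to_weakstar_continuous : Prop :=
  forall (y_ : nat -> X) (y : X), (forall i, U (y_ i)) -> U y ->
    weak_cvg y_ y ->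
    forall w : X, egrad (y_ i) w @[i --> \oo] --> egrad y w.

(* The values of psi on the negative numbers do not matter. *)
Definition uniformly_convex_rel (S1 S2 : set X) (psi : R -> \bar R) : Prop :=
  [/\ [/\ S1 !=set0, S2 !=set0, S1 `<=` edom & S2 `<=` edom],
      forall t : R, 0 <= t -> (0 <= psi t)%E,
      forall t : R, 0 < t -> (0 < psi t)%E
    & forall (t : R) x y, 0 < t -> t < 1 -> S1 x -> S2 y ->
        (b (t *: x + (1 - t) *: y)%R + (t * (1 - t))%:E * psi `|x - y|%R
         <= t%:E * b x + (1 - t)%:E * b y)%E].

Definition uniformly_convex_on (S : set X) : Prop :=
  exists psi, uniformly_convex_rel S S psi.

Definition strongly_convex_on (S : set X) (mu : R) : Prop :=
  0 < mu /\ uniformly_convex_rel S S (fun t => (2^-1 * mu * t ^+ 2)%:E).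

Definition uniformly_convex_at_infinity (C : set X) : Prop :=
  forall x, C x -> exists r : R,
    let A := [set y | U y /\ r <= `|y|] in
    [/\ 0 <= r, A !=set0
      & exists2 psi : R -> \bar R, uniformly_convex_rel [set x] A psi &
          psi t @[t --> +oo%R] --> +oo%E].

End bregman.

Section problem.
Context {R : realType} {X : completeNormedModType R}.
Variables (b : X -> \bar R) (U : set X) (C : set X).
Variables (f : X -> R) (g : X -> \bar R).

Definition feasible_set : Prop :=
  [/\ C `<=` edom b, C !=set0 /\ closed C, @convex_set R X C,
      more_than_one_point C & (C `&` U) !=set0].

(* f is only meaningful on the domain of b. *)
Definition smooth_part : Prop :=
  [/\ @convex_function R X (edom b) f,
      forall y, U y -> gateaux_differentiable f y
    & lsc_on C (EFin \o f)].

(* g is only meaningful on C. *)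
Definition nonsmooth_part : Prop :=
  [/\ econvex_on C g, proper_on C g & lsc_on C g].

Definition objective (x : X) : \bar R :=
  if x \in C then ((f x)%:E + g x)%E else +oo%E.

Definition minimizers : set X :=
  [set x | C x /\ objective x = ereal_inf [set objective z | z in C]].

Definition prox_model (L mu : R) (x y : X) : \bar R :=
  ((f y)%:E + (grad f y (x - y)%R)%:E + (L / mu)%:E * divergence b U x y + g x)%E.

(* [get P] is a point satisfying P, if there is one. *)
Definition prox (L mu : R) (S : set X) (y : X) : X :=
  get [set p | S p /\
    forall x, S x -> (prox_model L mu p y <= prox_model L mu x y)%E].

(* All sequences below are indexed from 1, their value at 0 is not used. *)

Definition telescopic (S : nat -> set X) (mu : nat -> R) : Prop :=
  [/\ forall k, (1 <= k)%N ->
        [/\ closed (S k), @convex_set R X (S k),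
            more_than_one_point (S k `&` U)
          & S k `<=` S k.+1 /\ S k.+1 `<=` C],
      forall k, (1 <= k)%N -> strongly_convex_on b (S k) (mu k),
      forall k, (1 <= k)%N -> mu k.+1 <= mu k,
      \bigcup_(k in [set k | (1 <= k)%N]) S k = C
    & proper_on (S 1%N) g].

Definition lipschitz_step_rule (S : nat -> set X) (mu : nat -> R)
    (x : nat -> X) (L : nat -> R) : Prop :=
  [/\ 0 < L 1%N, lip_const f (S 1%N `&` U) <= L 1%N, (S 1%N `&` U) (x 1%N)
    & forall k, (2 <= k)%N ->
        Num.max (L k.-1) (lip_const f (S k `&` U)) <= L k /\
        x k = prox (L k) (mu k) (S k) (x k.-1)].

Definition backtracking_test (S : set X) (mu L : R) (y : X) : Prop :=
  (objective (prox L mu S y) <= prox_model L mu (prox L mu S y) y)%E.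

Definition backtracking_step_rule (eta : R) (S : nat -> set X) (mu : nat -> R)
    (x : nat -> X) (L : nat -> R) : Prop :=
  [/\ 1 < eta, 0 < L 1%N,
      ~ (forall k, (1 <= k)%N -> S k = C) ->
        L 1%N <= eta * lip_const f (S 1%N `&` U),
      (S 1%N `&` U) (x 1%N)
    & forall k, (2 <= k)%N -> exists i : nat,
        [/\ backtracking_test (S k) (mu k) (eta ^+ i * L k.-1) (x k.-1),
            forall j, (j < i)%N ->
              ~ backtracking_test (S k) (mu k) (eta ^+ j * L k.-1) (x k.-1),
            L k = eta ^+ i * L k.-1
          & x k = prox (L k) (mu k) (S k) (x k.-1)]].

End problem.

(* Main.v *)
Require Import Defs.
From HB Require Import structures.
From mathcomp Require Import all_boot all_order all_algebra.
From mathcomp Require Import ring lra.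
From mathcomp Require Import all_classical all_reals all_analysis.

Set Implicit Arguments.
Unset Strict Implicit.
Unset Printing Implicit Defensive.

Import Order.TTheory GRing.Theory Num.Theory.
Import numFieldNormedType.Exports.

Local Open Scope classical_set_scope.
Local Open Scope ring_scope.

(** The proof has an elementary part, one inequality per step, and a
    functional-analytic part, which turns it into weak convergence.

    Each step minimizes a strongly convex model of the objective [F] over
    [S k], so the step [p] from [y] exists and satisfies a first-order
    optimality condition.  Together with the three-point identity of the
    Bregman divergence [D], the gradient inequality for [f] and the
    sufficient-decrease test [F p <= Q p y], this condition gives
    [F p - F z <= L / mu * (D z y - D z p)] for every [z] in [S k]
    ([prox_step_estimate]).  Backtracking enforces the test; under the Lipschitz
    rule it holds because strong convexity of [b] dominates the quadratic error
    of the descent lemma ([lipschitz_sufficient_decrease]).  With [z] the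
    previous iterate the estimate says that [F] decreases; with [z] a minimizer,
    which lies in [S k] from some stage on, it says that [D z (x k)] decreases.
    Multiplied by the nonincreasing weights [mu k / tau k] the estimates
    telescope to the rate of convergence ([gap_bound]), and the convergence of
    the values follows.

    For weak convergence, bounded level sets and the monotonicity of [D z (x k)]
    bound the iterates, so they have weakly convergent subsequences
    ([reflexive_bounded_subsequence]); the limits are minimizers, since closed
    convex sublevel sets are weakly closed; and two limits coincide, since the
    limiting difference property evaluates the limit of [D w1 (x k) - D w2 (x k)]
    as [D w1 w2] and as [- D w2 w1], so both divergences are 0
    ([weak_limits_unique]).  The compactness is
    derived from the hypothesis that functionals on the dual are evaluations,
    via ultrafilters and a Hahn-Banach theorem whose proof finds linear
    functionals as the minimal sublinear ones.

    Finally, weak-to-weak* continuity of the gradient gives the limiting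
    difference property at once, and a gauge tending to infinity bounds the
    level sets because it bounds the divergence below.  A function that is
    uniformly convex on its zone has such a gauge: the best modulus of uniform
    convexity grows at least quadratically with the distance
    ([gauge_value_dilate]), and it survives, up to a constant, when one end of
    the segment is only in the domain ([gauge_value_boundary]). *)

(** * Hahn-Banach and Mazur theorems *)

Section sublinear_functionals.
Context {R : realType} {V : lmodType R}.
Implicit Types (p q : V -> R) (D : set V).

Definition sublinear q : Prop :=
  [/\ forall u v, q (u + v) <= q u + q v,
      forall a v, 0 < a -> q (a *: v) <= a * q v
    & 0 <= q 0].

Definition segment_closed D : Prop := forall u v (t : R),
  D u -> D v -> 0 < t -> t < 1 -> D (t *: u + (1 - t) *: v).

Lemma sublinear0 q : sublinear q -> q 0 = 0.
Proof.
move=> [_ qZ q0]; apply/eqP; rewrite eq_le q0 andbT.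
have := qZ (2^-1) 0; rewrite scaler0 invr_gt0 ltr0n => /(_ isT); lra.
Qed.

Lemma sublinearZ q a v : sublinear q -> 0 <= a -> q (a *: v) = a * q v.
Proof.
move=> sq; rewrite le_eqVlt => /predU1P[<-|a0].
  by rewrite scale0r mul0r sublinear0.
have [_ qZ _] := sq; apply/eqP; rewrite eq_le qZ//=.
have := qZ a^-1 (a *: v); rewrite invr_gt0 => /(_ a0).
by rewrite scalerA mulVf ?gt_eqF// scale1r ler_pdivlMl.
Qed.

Lemma sublinear_ge_opp q v : sublinear q -> - q (- v) <= q v.
Proof.
by move=> sq; have [qD _ q0] := sq; have := qD v (- v); rewrite subrr; lra.
Qed.

(** Pushing a sublinear functional down along a convex set on which it stays
    above [d]: the largest sublinear minorant [p] of [q] with [p (- k) <= - d]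
    on [D].  Convexity of [D] is what makes the infimum subadditive. *)
Lemma sublinear_tilt q D d : sublinear q -> D !=set0 -> segment_closed D ->
  (forall k, D k -> d <= q k) ->
  exists2 p, sublinear p &
    (forall v, p v <= q v) /\ (forall k, D k -> p (- k) <= - d).
Proof.
move=> sq [k0 Dk0] Dconv dq; have [qD qZ _] := sq.
pose A v := [set q (v + tk.1 *: tk.2) - tk.1 * d
  | tk in [set tk : R * V | 0 <= tk.1 /\ D tk.2]].
pose p v := inf (A v).
(* The lower bound needed for the infimum to make sense comes from
   [q (t *: k) <= q (v + t *: k) + q (- v)]. *)
have A0 v : A v !=set0 by exists (q (v + 0 *: k0) - 0 * d), (0, k0).
have Alb v : lbound (A v) (- q (- v)).
  move=> _ [[t k] /= [t0 Dk] <-].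
  have := qD (v + t *: k) (- v); rewrite addrAC subrr add0r sublinearZ// => H.
  have := dq _ Dk => /(ler_wpM2l t0); lra.
have p_le v t k : 0 <= t -> D k -> p v <= q (v + t *: k) - t * d.
  move=> t0 Dk; apply: ge_inf; first by exists (- q (- v)); exact: Alb.
  by exists (t, k).
have pE v c : (forall t k, 0 <= t -> D k -> c <= q (v + t *: k) - t * d) ->
    c <= p v.
  by move=> H; apply: lb_le_inf => // _ [[t k] /= [t0 Dk] <-]; exact: H.
exists p; last split.
- split.
  + move=> u v; rewrite -lerBlDr; apply: (pE) => t k t0 Dk.
    rewrite lerBlDl -lerBlDr; apply: (pE) => s l s0 Dl.
    have [ts0|ts0] := ltP 0 (t + s); last first.
      have -> : t = 0 by lra.
      have -> : s = 0 by lra.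
      have := p_le (u + v) 0 k0; rewrite !scale0r !addr0 => /(_ (lexx _) Dk0).
      have := qD u v; lra.
    pose w := (t / (t + s)) *: k + (1 - t / (t + s)) *: l.
    have Dw : D w.
      rewrite /w; have [->|t_neq0] := eqVneq t 0.
        by rewrite mul0r subr0 scale0r add0r scale1r.
      have [->|s_neq0] := eqVneq s 0.
        by rewrite addr0 divff// subrr scale0r addr0 scale1r.
      have t_gt0 : 0 < t by rewrite lt_neqAle eq_sym t_neq0.
      have s_gt0 : 0 < s by rewrite lt_neqAle eq_sym s_neq0.
      apply: Dconv => //; first by rewrite divr_gt0.
      by rewrite ltr_pdivrMr// mul1r ltrDl.
    have tsw : (t + s) *: w = t *: k + s *: l.
      rewrite scalerDr !scalerA mulrBr mulr1 mulrC divfK ?gt_eqF//.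
      by rewrite addrAC subrr add0r.
    have := p_le (u + v) (t + s) w (ltW ts0) Dw; rewrite tsw addrACA.
    have := qD (u + t *: k) (v + s *: l); lra.
  + move=> a v a0; rewrite -ler_pdivrMl//; apply: (pE) => t k t0 Dk.
    rewrite ler_pdivrMl//.
    have := p_le (a *: v) (a * t) k (mulr_ge0 (ltW a0) t0) Dk.
    rewrite -scalerA -scalerDr; have := qZ a (v + t *: k) a0; lra.
  + apply: (pE) => t k t0 Dk; rewrite add0r sublinearZ// subr_ge0.
    exact: ler_wpM2l (dq _ Dk).
- by move=> v; have := p_le v 0 k0; rewrite scale0r addr0 mul0r subr0; apply.
- move=> k Dk; have := p_le (- k) 1 k ler01 Dk.
  by rewrite scale1r addNr sublinear0// mul1r sub0r.
Qed.

(** Hahn-Banach in the form: a minimal sublinear functional is linear.  Indeed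
    tilting it at a point [a] cannot lower it, so it is odd.  Minimal elements
    exist by Zorn, the infimum of a chain being bounded below by
    [- q (- v)]. *)
Theorem sublinear_ge_linear q : sublinear q ->
  exists2 l : V -> R, scalar l & forall v, l v <= q v.
Proof.
move=> sq; pose P (l : V -> R) := sublinear l /\ forall v, l v <= q v.
pose T := {l : V -> R | P l}.
pose le_fun (l m : {classic T}) := `[< forall v, sval m v <= sval l v >].
have [||chain|[l [sl lq]] lmin] := @ZL_preorder {classic T}
    (exist P q (conj sq (fun=> lexx _))) le_fun.
- by move=> l; apply/asboolP.
- move=> m l n /asboolP lm /asboolP mn; apply/asboolP => v.
  exact: le_trans (mn v) (lm v).
- move=> total; have [[m0 cm0]|chain0] := pselect (chain !=set0); last first.
    exists (exist P q (conj sq (fun=> lexx _))) => s cs.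
    by case: chain0; exists s.
  pose A v := [set sval m v | m in chain].
  have A0 v : A v !=set0 by exists (sval m0 v), m0.
  have Alb v : lbound (A v) (- q (- v)).
    move=> _ [[m [sm mq]] _ <-] /=.
    by have := sublinear_ge_opp v sm; have := mq (- v); lra.
  have inf_le v m : chain m -> inf (A v) <= sval m v.
    move=> cm; apply: ge_inf; first by exists (- q (- v)); exact: Alb.
    by exists m.
  have le_inf v c : (forall m, chain m -> c <= sval m v) -> c <= inf (A v).
    by move=> H; apply: lb_le_inf => // _ [m cm <-]; exact: H.
  have sinf : sublinear (fun v => inf (A v)).
    split.
    + move=> u v; rewrite -lerBlDr; apply: (le_inf) => m cm.
      rewrite lerBlDl -lerBlDr; apply: (le_inf) => n cn; rewrite lerBlDr.
      have [/asboolP mn|/asboolP nm] := total _ _ cm cn.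
      * apply: le_trans (inf_le _ _ cn) _.
        have [nD _ _] := (svalP n).1.
        by apply: le_trans (nD u v) _; rewrite addrC lerD2l.
      * apply: le_trans (inf_le _ _ cm) _.
        have [mD _ _] := (svalP m).1.
        by apply: le_trans (mD u v) _; rewrite addrC lerD2r.
    + move=> a v a0; rewrite -ler_pdivrMl//; apply: (le_inf) => m cm.
      rewrite ler_pdivrMl//; apply: le_trans (inf_le _ _ cm) _.
      by have [_ mZ _] := (svalP m).1; exact: mZ.
    + by apply: (le_inf) => m cm; have [_ _] := (svalP m).1.
  have infq v : inf (A v) <= q v.
    by apply: le_trans (inf_le _ _ cm0) _; exact: (svalP m0).2.
  exists (exist P (fun v => inf (A v)) (conj sinf infq)) => m cm; apply/asboolP => v /=.
  exact: inf_le.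
exists l => // a u v.
have [lD _ _] := sl.
(* Minimality forces the tilt of [l] at [a'] to be [l] itself. *)
have lN a' : l (- a') = - l a'.
  have [||_ ->|p sp [pl pN]] := @sublinear_tilt l [set a'] (l a') sl.
  - by exists a'.
  - by move=> _ _ t -> -> t0 t1; rewrite -scalerDl addrC subrK scale1r.
  - by [].
  have pq w : p w <= q w by exact: le_trans (pl w) (lq w).
  have /asboolP/(_ (- a')) /= := lmin (exist P p (conj sp pq)) (asboolT pl).
  by have := pN a' erefl; have := sublinear_ge_opp (- a') sl; rewrite opprK; lra.
have ladd u' v' : l (u' + v') = l u' + l v'.
  have := lD (u' + v') (- v'); rewrite addrK lN.
  have := lD u' v'; lra.
have lZ b : l (b *: u) = b * l u.
  have [b0|b0] := leP 0 b; first exact: sublinearZ.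
  rewrite -[b *: u]opprK -scaleNr lN sublinearZ//; lra.
by rewrite ladd lZ.
Qed.

End sublinear_functionals.

Section dual_functionals.
Context {R : realType} {X : completeNormedModType R}.
Implicit Types (l : X -> R) (K D : set X).

Lemma dual0 l : dual l -> l 0 = 0.
Proof. by move=> [ls _]; have := ls (-1) 0 0; rewrite scaler0 addr0; lra. Qed.

Lemma dualD l u v : dual l -> l (u + v) = l u + l v.
Proof. by move=> [ls _]; have := ls 1 u v; rewrite scale1r mul1r. Qed.

Lemma dualZ l a v : dual l -> l (a *: v) = a * l v.
Proof.
move=> dl; have [ls _] := dl.
by have := ls a v 0; rewrite addr0 dual0// addr0.
Qed.

Lemma dualN l v : dual l -> l (- v) = - l v.
Proof. by move=> dl; rewrite -scaleN1r dualZ// mulN1r. Qed.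

Lemma dualB l u v : dual l -> l (u - v) = l u - l v.
Proof. by move=> dl; rewrite dualD// dualN. Qed.

Lemma scalar_le_norm_dual l :
  scalar l -> (forall v, l v <= `|v|) -> dual l /\ forall v, `|l v| <= `|v|.
Proof.
move=> ls l_le.
have l0 : l 0 = 0 by have := ls (-1) 0 0; rewrite scaler0 addr0; lra.
have lB u v : l (u - v) = l u - l v.
  by have := ls (-1) v u; rewrite scaleN1r (addrC (- v)) => ->; lra.
have l_abs v : `|l v| <= `|v|.
  rewrite ler_norml l_le andbT lerNl.
  by have := l_le (- v); rewrite -[- v]sub0r lB l0 !sub0r normrN.
split=> //; split=> // u; apply/cvgrPdist_lt => e e0.
near=> v; rewrite -lB; apply: le_lt_trans (l_abs _) _.
near: v; exact: cvgr_dist_lt.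
Unshelve. all: by end_near. Qed.

(** The sublinear functional [p] below is the norm tilted along [D], so a
    linear minorant of it separates [D] from the origin by the whole
    distance [d]; no Minkowski gauge is needed. *)
Lemma separation_from_origin D (d : R) : D !=set0 -> segment_closed D ->
  (forall k, D k -> d <= `|k|) ->
  exists l, [/\ dual l, forall v, `|l v| <= `|v| & forall k, D k -> d <= l k].
Proof.
move=> D0 Dconv dD.
have norm_sublinear : sublinear (fun v : X => `|v|).
  split=> [u v|a v a0|]; first exact: ler_normD.
  - by rewrite normrZ gtr0_norm.
  - by rewrite normr0.
have [p sp [p_le pN]] := sublinear_tilt norm_sublinear D0 Dconv dD.
have [l ls lp] := sublinear_ge_linear sp.
have [dl labs] : dual l /\ forall v, `|l v| <= `|v|.
  by apply: scalar_le_norm_dual => // v; exact: le_trans (lp v) (p_le v).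
exists l; split=> // k Dk.
by have := le_trans (lp (- k)) (pN k Dk); rewrite dualN// lerN2.
Qed.

Lemma norming_functional (y : X) :
  exists l, [/\ dual l, forall v, `|l v| <= `|v| & l y = `|y|].
Proof.
have [|||l [dl l_le ly]] := @separation_from_origin [set y] `|y|.
- by exists y.
- by move=> _ _ t -> -> _ _; rewrite -scalerDl addrC subrK scale1r.
- by move=> _ ->.
exists l; split=> //; apply/eqP; rewrite eq_le ly// andbT.
exact: le_trans (ler_norm _) (l_le y).
Qed.

(** Mazur: a point at positive distance from a closed convex set is separated
    from it by a functional, hence not in its weak closure. *)
Lemma closed_convex_weakly_closed K (z : X) : closed K -> segment_closed K ->
  (forall l, dual l -> forall e : R, 0 < e -> exists2 k, K k & `|l k - l z| < e) ->
  K z.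
Proof.
move=> Kcl Kconv wz; apply: contrapT => Kz.
have [k0 Kk0 _] : exists2 k, K k & `|(fun=> 0 : R) k - (fun=> 0 : R) z| < 1.
  apply: (wz (fun=> 0)) => //; split; last exact: cst_continuous.
  by move=> a u v; rewrite mulr0 addr0.
have /nbhs_ballP[d /= d0 zd] : nbhs z (~` K).
  by apply: open_nbhs_nbhs; split => //; exact: closed_openC.
pose D := [set k - z | k in K].
have [|||l [dl _ lD]] := @separation_from_origin D d.
- by exists (k0 - z), k0.
- move=> _ _ t [u Ku <-] [v Kv <-] t0 t1; exists (t *: u + (1 - t) *: v).
    exact: Kconv.
  rewrite !scalerBr addrACA; congr (_ + _).
  by rewrite -opprD -scalerDl addrC subrK scale1r.
- move=> _ [k Kk <-]; rewrite leNgt; apply/negP => kz.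
  by apply: (zd k) => //; rewrite -ball_normE /= distrC.
have [k Kk] := wz l dl d d0; apply/negP; rewrite -leNgt -dualB//.
by apply: le_trans (ler_norm _); apply: lD; exists k.
Qed.

Lemma weak_cvg_closed_convex K (y : nat -> X) z : closed K ->
  segment_closed K -> (\forall i \near \oo, K (y i)) -> weak_cvg y z -> K z.
Proof.
move=> Kcl Kconv Ky yz; apply: closed_convex_weakly_closed => // l dl e e0.
have /cvgrPdist_lt/(_ _ e0) lyz := yz l dl.
near \oo => i; exists (y i); first by near: i.
rewrite distrC; near: i; exact: lyz.
Unshelve. all: by end_near. Qed.

End dual_functionals.

(** * Weak sequential compactness in reflexive spaces *)

Lemma ultrafilter_cvg_bounded (R : realType) (T : Type) (G : set_system T)
    (h : T -> R) (M : R) : UltraFilter G -> (forall t, `|h t| <= M) ->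
  exists2 p : R, h @ G --> p & `|p| <= M.
Proof.
move=> UG hM.
have [|p [pM hp]] := @segment_compact R (- M) M (h @ G) _.
  rewrite /= nbhs_simpl /=; apply: filterS filterT => t _ /=.
  by rewrite in_itv/= -ler_norml.
exists p; last by rewrite ler_norml; move: pM; rewrite /= in_itv.
move=> A Ap; have [//|GnA] := in_ultra_setVsetC (h @^-1` A) UG.
by have [q [nAq Aq]] := hp (~` A) A GnA Ap.
Qed.

Section weak_sequential_compactness.
Context {R : realType} {X : completeNormedModType R}.
Hypothesis X_reflexive : reflexive_space X.
Implicit Types l : X -> R.

Lemma reflexive_ultrafilter_limit (T : Type) (G : set_system T)
    (y : T -> X) (M : R) : UltraFilter G -> (forall t, `|y t| <= M) ->
  exists z, forall l, dual l -> l \o y @ G --> l z.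
Proof.
move=> UG yM; pose M' := Num.max M 1.
(* [M'] is positive, so the products with an infinite dual norm are [+oo]. *)
have M'0 : 0 < M' by rewrite lt_max ltr01 orbT.
have M'_neq0 : M' != 0 by rewrite gt_eqF.
have yM' t : `|M'^-1 *: y t| <= 1.
  rewrite normrZ gtr0_norm ?invr_gt0// ler_pdivrMl// mulr1.
  by apply: le_trans (yM t) _; rewrite le_max lexx.
have ly l : dual l -> forall t, (`|l (y t)|%:E <= M'%:E * dual_norm l)%E.
  move=> dl t; rewrite -(scale1r (y t)) -(divff M'_neq0) -scalerA dualZ//.
  rewrite normrM gtr0_norm// EFinM lee_pmul2l ?lte_fin//.
  by apply: ereal_sup_ubound; exists (M'^-1 *: y t); first exact: yM'.
have lcvg l : dual l -> exists p, l \o y @ G --> p /\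
    (`|p|%:E <= M'%:E * dual_norm l)%E.
  move=> dl.
  (* The uniform bound comes from continuity at 0: the dual norm is not yet
     known to be finite. *)
  have [N lyN] : exists N, forall t, `|l (y t)| <= N.
    have [_ /(_ 0)/cvgrPdist_lt/(_ 1 ltr01)] := dl.
    rewrite dual0// => /nbhs_ballP[d /= d0 hd].
    exists (2 * M' / d) => t.
    have : `|l ((d / (2 * M')) *: y t)| <= 1.
      have := hd ((d / (2 * M')) *: y t); rewrite sub0r normrN => H.
      apply/ltW/H; rewrite -ball_normE /= sub0r normrN normrZ.
      rewrite gtr0_norm ?divr_gt0 ?mulr_gt0//.
      have := yM' t; rewrite normrZ gtr0_norm ?invr_gt0// ler_pdivrMl// mulr1.
      move=> /(ler_wpM2l (ltW (divr_gt0 d0 (mulr_gt0 (ltr0Sn _ 1) M'0)))).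
      move=> /le_lt_trans; apply; rewrite invfM mulrA divfK//; lra.
    rewrite dualZ// normrM gtr0_norm ?divr_gt0 ?mulr_gt0// -ler_pdivlMl.
      by rewrite invf_div mulr1.
    by rewrite divr_gt0 ?mulr_gt0.
  have [p lp _] := ultrafilter_cvg_bounded UG lyN.
  exists p; split => //.
  have [->|dnoo] := eqVneq (dual_norm l) +oo%E.
    by rewrite gt0_muley ?lte_fin// leey.
  have dn0 : (0 <= dual_norm l)%E.
    by apply: ereal_sup_ubound; exists 0; [rewrite /= normr0|rewrite dual0 // normr0].
  have dnfin : dual_norm l \is a fin_num by rewrite ge0_fin_numE// ltey.
  have ly' t : `|l (y t)| <= M' * fine (dual_norm l).
    by rewrite -lee_fin EFinM fineK//; exact: ly.
  have [q lq qle] := ultrafilter_cvg_bounded UG ly'.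
  have -> : p = q by exact: cvg_unique lp lq.
  by move: qle; rewrite -lee_fin EFinM fineK.
pose Phi l := lim (l \o y @ G).
have Phi_cvg l : dual l -> l \o y @ G --> Phi l.
  by move=> /lcvg[p [lp _]]; apply/cvg_ex; exists p.
have [||z zPhi] := X_reflexive (Phi := Phi).
- move=> a l m dl dm.
  have dlm : dual (fun v => a * l v + m v).
    split=> [b u v|v].
      by rewrite (dualD _ _ dl) (dualD _ _ dm) (dualZ _ _ dl) (dualZ _ _ dm); ring.
    by apply: cvgD; [apply: cvgMr; exact: dl.2|exact: dm.2].
  apply: cvg_unique (Phi_cvg _ dlm) _ => //.
  by apply: cvgD; [apply: cvgMr|]; exact: Phi_cvg.
- exists M' => l dl; have [p [lp]] := lcvg _ dl.
  by rewrite (cvg_unique _ lp (Phi_cvg _ dl)).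
by exists z => l dl; rewrite -zPhi//; exact: Phi_cvg.
Qed.

(** Only countably many functionals have to be controlled on the closed span
    of a sequence, because its rational combinations are dense there. *)
Definition rat_comb (y : nat -> X) (s : seq rat) : X :=
  \sum_(i < size s) ratr s`_i *: y i.

Definition closed_span (y : nat -> X) : set X :=
  [set w | forall e : R, 0 < e -> exists s, `|w - rat_comb y s| < e].

Lemma rat_comb_widen y s n : (size s <= n)%N ->
  rat_comb y s = \sum_(i < n) ratr s`_i *: y i.
Proof.
move=> sn; rewrite /rat_comb (big_ord_widen n (fun i => ratr s`_i *: y i) sn).
rewrite big_mkcond; apply: eq_bigr => i _; case: ltnP => // si.
by rewrite nth_default// rmorph0 scale0r.
Qed.

Lemma rat_combD y s t : exists u, rat_comb y u = rat_comb y s + rat_comb y t.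
Proof.
set n := maxn (size s) (size t); exists (mkseq (fun i => s`_i + t`_i) n).
rewrite (@rat_comb_widen y s n) ?leq_maxl// (@rat_comb_widen y t n) ?leq_maxr//.
rewrite (@rat_comb_widen y _ n) ?size_mkseq// -big_split/=.
by apply: eq_bigr => i _; rewrite nth_mkseq// rmorphD scalerDl.
Qed.

Lemma rat_combZ y (q : rat) s : exists u, rat_comb y u = ratr q *: rat_comb y s.
Proof.
exists (map ( *%R q) s); rewrite /rat_comb size_map scaler_sumr.
by apply: eq_bigr => i _; rewrite (nth_map 0)// rmorphM scalerA.
Qed.

Lemma closed_span_mem y k : closed_span y (y k).
Proof.
move=> e e0; exists (rcons (nseq k 0) 1).
rewrite /rat_comb size_rcons size_nseq big_ord_recr/= nth_rcons size_nseq ltnn.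
rewrite eqxx rmorph1 scale1r big1 ?add0r ?subrr ?normr0// => i _.
by rewrite nth_rcons size_nseq ltn_ord nth_nseq ltn_ord rmorph0 scale0r.
Qed.

Lemma closed_spanD y u v :
  closed_span y u -> closed_span y v -> closed_span y (u + v).
Proof.
move=> uY vY e e0; have e20 : 0 < e / 2 by rewrite divr_gt0.
have [s us] := uY _ e20; have [t vt] := vY _ e20.
have [r rE] := rat_combD y s t; exists r; rewrite rE opprD addrACA.
by apply: le_lt_trans (ler_normD _ _) _; lra.
Qed.

Lemma closed_spanZ y (a : R) u : closed_span y u -> closed_span y (a *: u).
Proof.
move=> uY e e0; have e20 : 0 < e / 2 by rewrite divr_gt0.
have a0 : 0 < `|a| + 1 by rewrite ltr_wpDl.
have [s us] := uY _ (divr_gt0 e20 a0).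
set c := rat_comb y s in us.
have c0 : 0 < `|c| + 1 by rewrite ltr_wpDl.
have ed0 := divr_gt0 e20 c0; set d := e / 2 / (`|c| + 1) in ed0.
have /rat_in_itvoo[q] : a - d < a + d by lra.
rewrite in_itv/= => /andP[aq qa].
have [t tE] := rat_combZ y q s; exists t; rewrite tE -/c.
have -> : a *: u - ratr q *: c = a *: (u - c) + (a - ratr q) *: c.
  by rewrite scalerBr scalerBl addrA subrK.
apply: le_lt_trans (ler_normD _ _) _; rewrite !normrZ.
have H1 : `|a| * `|u - c| <= e / 2.
  apply: (@le_trans _ _ ((`|a| + 1) * (e / 2 / (`|a| + 1)))).
    by apply: ler_pM => //; [rewrite lerDl|exact: ltW].
  by rewrite mulrC divfK// gt_eqF.
have H2 : `|a - ratr q| * `|c| < e / 2.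
  apply: (@le_lt_trans _ _ (d * `|c|)).
    by apply: ler_wpM2r => //; rewrite ler_norml; apply/andP; split; lra.
  have -> : e / 2 = d * (`|c| + 1) by rewrite divfK// gt_eqF.
  by rewrite ltr_pM2l// ltrDl.
lra.
Qed.

Lemma closed_span_closed y : closed (closed_span y).
Proof.
move=> w wY e e0; have e20 : 0 < e / 2 by rewrite divr_gt0.
have [v [vY]] := wY _ (nbhsx_ballx w (e / 2) e20).
rewrite -ball_normE /= => wv; have [s vs] := vY _ e20; exists s.
rewrite -(subrKA v); apply: le_lt_trans (ler_normD _ _) _; lra.
Qed.

Lemma closed_span_segment y : segment_closed (closed_span y).
Proof. by move=> u v t uY vY _ _; apply: closed_spanD; exact: closed_spanZ. Qed.

Lemma strictly_increasing_choice (P : nat -> nat -> Prop) :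
  (forall j N, exists2 k, (N <= k)%N & P j k) ->
  exists2 sigma : nat -> nat, (forall j, (sigma j < sigma j.+1)%N) &
    forall j, P j (sigma j).
Proof.
move=> H; have H' jN : exists k, (jN.2 <= k)%N /\ P jN.1 k.
  by have [k ? ?] := H jN.1 jN.2; exists k.
have [phi phiP] := choice H'.
pose fix sigma j := if j is i.+1 then phi (i.+1, (sigma i).+1) else phi (0, 0)%N.
exists sigma; first by move=> j; exact: (phiP (j.+1, (sigma j).+1)).1.
by case=> [|j]; [exact: (phiP (0, 0)%N).2|exact: (phiP (j.+1, _)).2].
Qed.

Lemma strictly_increasing_ge (sigma : nat -> nat) :
  (forall j, (sigma j < sigma j.+1)%N) -> forall j, (j <= sigma j)%N.
Proof. by move=> H; elim=> // j IH; exact: leq_ltn_trans IH (H j). Qed.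

(** The weak limit [z] along an ultrafilter is reached by a subsequence for
    countably many functionals norming the rational combinations.  These
    separate the points of the closed span, which contains, by Mazur, all weak
    ultrafilter limits of that subsequence; so they all coincide with [z]. *)
Theorem reflexive_bounded_subsequence (y : nat -> X) (M : R) :
  (forall k, `|y k| <= M) ->
  exists sigma : nat -> nat, (forall j, (sigma j < sigma j.+1)%N) /\
    exists z, weak_cvg (y \o sigma) z.
Proof.
move=> yM.
have span_limit (h : nat -> nat) (G : set_system nat) w : ProperFilter G ->
    (forall l, dual l -> l \o (y \o h) @ G --> l w) -> closed_span y w.
  move=> PG wG; apply: closed_convex_weakly_closed.
  - exact: closed_span_closed.
  - exact: closed_span_segment.
  - move=> l dl e e0; have /cvgrPdist_lt/(_ e e0)/filter_ex[k lk] := wG l dl.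
    by exists (y (h k)); [exact: closed_span_mem|rewrite distrC].
have [G [UG ooG]] := ultraFilterLemma eventually_filter.
have [z zG] := reflexive_ultrafilter_limit UG yM.
have zY : closed_span y z by exact: (span_limit id G).
have [nu nuP] := choice (fun s => norming_functional (rat_comb y s)).
(* The functionals are enumerated through the countability of [seq rat]. *)
pose l_ n := if unpickle n is Some s then nu s else fun=> 0.
have dl_ n : dual (l_ n).
  rewrite /l_; case: (unpickle n) => [s|]; first by have [] := nuP s.
  by split=> [a u v|]; [rewrite mulr0 addr0|exact: cst_continuous].
have [|sigma sigmaS sigmaP] := strictly_increasing_choice (P :=
    fun j k => forall n, (n < j)%N -> `|l_ n (y k) - l_ n z| < j.+1%:R^-1).
  move=> j N.
  have GN : G [set k | (N <= k)%N] by apply: ooG; exists N.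
  have Gn m : G [set k | forall n, (n < m)%N ->
      `|l_ n (y k) - l_ n z| < j.+1%:R^-1].
    elim: m => [|m IH]; first by apply: filterS filterT => k _ n.
    have j0 : 0 < j.+1%:R^-1 :> R by rewrite invr_gt0.
    have /cvgrPdist_lt/(_ _ j0) Gm := zG _ (dl_ m).
    apply: filterS2 Gm IH => k km kn n; rewrite ltnS leq_eqVlt.
    by move=> /predU1P[->|]; [rewrite distrC|exact: kn].
  by have [k [Nk kP]] := filter_ex (filterI GN (Gn j)); exists k.
exists sigma; split=> //; exists z => l dl.
apply: contrapT => /cvgrPdist_lt; apply => e e0; apply: contrapT => far.
(* Otherwise some ultrafilter concentrates on indices where [l] is far from
   [l z], although its weak limit is [z] as well. *)
pose Far := [set j | e <= `|l z - l (y (sigma j))|].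
have PF : ProperFilter (within Far \oo).
  apply: Build_ProperFilter_ex.
  move=> A [N _ NA]; apply: contrapT => nA; apply: far; exists N => // j Nj.
  by rewrite ltNge; apply/negP => Fj; apply: nA; exists j; exact: NA.
have [H [UH FH]] := ultraFilterLemma PF.
have ooH : \oo `<=` H.
  by move=> A ooA; apply: FH; apply: filterS ooA => j Aj _.
have [w wH] := reflexive_ultrafilter_limit UH (fun j => yM (sigma j)).
have wY : closed_span y w by exact: (span_limit sigma H).
have lw n : l_ n w = l_ n z.
  apply: cvg_unique (wH _ (dl_ n)) _ => //; apply/cvgrPdist_lt => d d0.
  near=> j.
  rewrite distrC /=; have nj : (n < j)%N by near: j; apply: ooH; exists n.+1.
  apply: lt_trans (sigmaP j n nj) _.
  near: j; apply: ooH; exact: near_infty_natSinv_lt (PosNum d0).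
have wz : w = z.
  apply/eqP; rewrite -subr_eq0 -normr_eq0; apply/eqP/le_anti.
  rewrite normr_ge0 andbT; apply/ler_addgt0Pr => d d0; rewrite add0r.
  have d20 : 0 < d / 2 by rewrite divr_gt0.
  have wzY : closed_span y (w - z).
    by apply: closed_spanD => //; rewrite -scaleN1r; exact: closed_spanZ.
  have [s ws] := wzY _ d20; have [ds nu_le nus] := nuP s.
  have nuwz : nu s (w - z) = 0.
    have := lw (pickle s); rewrite /l_ pickleK => nuE.
    by rewrite dualB// nuE subrr.
  have : `|rat_comb y s| < d / 2.
    rewrite -nus -[nu s _]subr0 -nuwz -dualB//.
    apply: le_lt_trans (ler_norm _) _; apply: le_lt_trans (nu_le _) _.
    by rewrite distrC.
  have := ler_normB (w - z) (rat_comb y s - (w - z)).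
  have := ler_normD (w - z - rat_comb y s) (rat_comb y s).
  rewrite subrK; lra.
have HF : H Far by apply: FH; apply: nearW => j.
have /cvgrPdist_lt/(_ e e0) := wH _ dl; rewrite wz => /(filterI HF)/filter_ex.
by move=> [j [Fj]]; rewrite /= ltNge; move: Fj => /= ->.
Unshelve. all: by end_near. Qed.

(** Opial-type criterion: a bounded sequence all of whose weak subsequential
    limits are equal converges weakly. *)
Corollary weak_cvg_unique_subsequential_limit (y : nat -> X) (M : R) z :
  (forall k, `|y k| <= M) ->
  (forall (sigma : nat -> nat) w, (forall j, (sigma j < sigma j.+1)%N) ->
     weak_cvg (y \o sigma) w -> w = z) ->
  weak_cvg y z.
Proof.
move=> yM uniq l dl; apply: contrapT => /cvgrPdist_lt; apply => e e0.
apply: contrapT => far.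
have [|sigma sigmaS sigmaP] :=
    strictly_increasing_choice (P := fun _ k => e <= `|l z - l (y k)|).
  move=> _ N; apply: contrapT => noF; apply: far; exists N => // k Nk.
  by rewrite ltNge; apply/negP => Fk; apply: noF; exists k.
have [tau [tauS [w yw]]] :=
  reflexive_bounded_subsequence (fun j => yM (sigma j)).
have stS j : (sigma (tau j) < sigma (tau j.+1))%N.
  have smono : {homo sigma : m n / (m < n)%N}.
    by apply: homo_ltn => //; exact: ltn_trans.
  exact: smono.
have wz : w = z by apply: (uniq (sigma \o tau)).
have /cvgrPdist_lt/(_ e e0)/filter_ex[j] := yw l dl.
by rewrite wz ltNge sigmaP.
Qed.

End weak_sequential_compactness.

(** * Segments, lower semicontinuity and strongly convex minimization *)

Lemma convex_set_segment (R : realType) (X : completeNormedModType R)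
  (A : set X) : @convex_set R X A -> segment_closed A.
Proof.
move=> cA x y t Ax Ay t0 t1.
have := cA x y (Itv01 (ltW t0) (ltW t1)) (mem_set Ax) (mem_set Ay).
by move=> /set_mem.
Qed.

Lemma convE (R : realType) (V : lmodType R) (x y : V) (t : R) :
  t *: x + (1 - t) *: y = t *: (x - y) + y.
Proof. by rewrite scalerBl scale1r scalerBr addrA addrAC. Qed.

Section lower_semicontinuity.
Context {R : realType} {X : completeNormedModType R}.
Implicit Types (A : set X) (u v : X -> \bar R).

Definition lsc_within A u : Prop := forall x, A x -> forall a : R,
  (a%:E < u x)%E -> \forall y \near x, A y -> (a%:E < u y)%E.

Lemma lsc_on_within A u : lsc_on A u -> lsc_within A u.
Proof.
move=> lscu x Ax a au; have [W xW aW] := lscu x a au.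
have : within A (nbhs x) W by rewrite (nbhs_subspace_in Ax).
by apply: filterS => y; exact: aW.
Qed.

Lemma lsc_within_lsc A u : lower_semicontinuous u -> lsc_within A u.
Proof.
by move=> lscu x _ a /lscu[W xW aW]; apply: filterS xW => y /aW.
Qed.

Lemma lsc_within_continuous A (r : X -> R) :
  continuous r -> lsc_within A (fun x => (r x)%:E).
Proof.
move=> cr x _ a; rewrite lte_fin => ar.
by have := cr x => /cvgr_gt/(_ a ar); apply: filterS => y; rewrite lte_fin.
Qed.

Lemma lsc_within_scale A u (c : R) : 0 < c -> lsc_within A u ->
  lsc_within A (fun x => (c%:E * u x)%E).
Proof.
move=> c0 lscu x Ax a acu.
have c0E : (0 < c%:E)%E by rewrite lte_fin.
have mulE (w : \bar R) : (a%:E < c%:E * w)%E = ((c^-1 * a)%:E < w)%E.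
  by rewrite -[RHS](@lte_pmul2l _ c%:E)// -EFinM mulrA divff ?gt_eqF// mul1r.
move: acu; rewrite mulE => /(lscu x Ax); apply: filterS => y.
by rewrite mulE.
Qed.

Lemma lte_adde_split (a : R) (s t : \bar R) :
  (-oo < s)%E -> (-oo < t)%E -> (a%:E < s + t)%E ->
  exists p q : R, [/\ (p%:E < s)%E, (q%:E < t)%E & a <= p + q].
Proof.
case: s t => [s| |] [t| |] //= _ _.
- rewrite -EFinD lte_fin => ast; exists (s - (s + t - a) / 2).
  by exists (t - (s + t - a) / 2); rewrite !lte_fin; split; lra.
- by exists (s - 1), (a - s + 1); rewrite lte_fin ltry; split => //; lra.
- by exists (a - t + 1), (t - 1); rewrite lte_fin ltry; split => //; lra.
- by exists a, 0; rewrite !ltry; split => //; lra.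
Qed.

Lemma lsc_withinD A u v : (forall x, A x -> (-oo < u x)%E) ->
  (forall x, A x -> (-oo < v x)%E) ->
  lsc_within A u -> lsc_within A v -> lsc_within A (fun x => (u x + v x)%E).
Proof.
move=> uoo voo lscu lscv x Ax a /(lte_adde_split (uoo x Ax) (voo x Ax)).
move=> [p [q [/(lscu x Ax) up /(lscv x Ax) vq apq]]].
apply: filterS2 up vq => y pu qv Ay.
apply: (@le_lt_trans _ _ (p%:E + q%:E)%E); first by rewrite -EFinD lee_fin.
by apply: lteD; [exact: pu|exact: qv].
Qed.

Lemma lsc_within_sublevel_closed A u (a : R) : closed A -> lsc_within A u ->
  closed [set x | A x /\ (u x <= a%:E)%E].
Proof.
move=> Acl lscu x xcl.
have Ax : A x by apply: Acl => W /xcl[y [[Ay _] Wy]]; exists y.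
split=> //; rewrite leNgt; apply/negP => /(lscu x Ax)/xcl[y [[Ay ya] auy]].
by have := auy Ay; rewrite ltNge ya.
Qed.

Lemma lsc_withinS A A' u : A' `<=` A -> lsc_within A u -> lsc_within A' u.
Proof.
move=> sA lscu x /sA Ax a /(lscu x Ax).
by apply: filterS => y Ayu /sA.
Qed.

End lower_semicontinuity.

(** Strong convexity alone bounds the function below and makes minimizing
    sequences Cauchy, so completeness is enough for existence. *)
Lemma strongly_convex_minimizer (R : realType) (X : completeNormedModType R)
    (D : set X) (h : X -> R) (c : R) : 0 < c -> D !=set0 -> segment_closed D ->
  (forall x y t, D x -> D y -> 0 < t -> t < 1 ->
    h (t *: x + (1 - t) *: y) + t * (1 - t) * c * `|x - y| ^+ 2
      <= t * h x + (1 - t) * h y) ->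
  (forall a, closed [set x | D x /\ h x <= a]) ->
  exists2 p, D p & forall x, D x -> h p <= h x.
Proof.
move=> c0 [x0 Dx0] Dconv hconv hcl.
have [r /= r0 hr] : exists2 r : R, 0 < r &
    forall x, D x -> `|x0 - x| < r -> h x0 - 1 < h x.
  have : nbhs x0 (~` [set x | D x /\ h x <= h x0 - 1]).
    apply: open_nbhs_nbhs; split; first exact/closed_openC/hcl.
    by move=> /= [_]; apply/negP; rewrite -ltNge; lra.
  move=> /nbhs_ballP[r /= r0 rball]; exists r => // x Dx xr.
  by rewrite ltNge; apply/negP => xh; apply: (rball x) => //; rewrite -ball_normE.
have [m0 m0h] : exists m0, forall x, D x -> m0 <= h x.
  have [k kdef] : exists k, k = 2 / r + c * r / 2 by exists (2 / r + c * r / 2).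
  (* Away from [x0], comparison with the point at distance [r / 2] from [x0] on
     the segment to [x] bounds [h x] below by
     [h x0 + c * d ^+ 2 - k * d], a quadratic in the distance [d]. *)
  exists (h x0 - 1 - k ^+ 2 / (4 * c)) => x Dx.
  have k2 : 0 <= k ^+ 2 / (4 * c).
    by rewrite divr_ge0 ?sqr_ge0// mulr_ge0// ltW.
  have [/(hr x Dx)|rd] := ltP `|x0 - x| r; first by lra.
  move: rd; set d := `|x0 - x| => rd; have d0 : 0 < d by exact: lt_le_trans rd.
  pose t := r / (2 * d).
  have t0 : 0 < t by rewrite divr_gt0// mulr_gt0.
  have t1 : t < 1 by rewrite ltr_pdivrMr ?mulr_gt0//; lra.
  have td : t * d = r / 2 by rewrite /t invfM mulrA divfK// gt_eqF.
  have q_near : h x0 - 1 < h (t *: x + (1 - t) *: x0).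
    apply: hr; first exact: Dconv.
    rewrite convE opprD addrCA subrr addr0 normrN normrZ gtr0_norm//.
    by rewrite distrC td; lra.
  have := hconv x x0 t Dx Dx0 t0 t1; rewrite (distrC x) -/d => hq.
  have kE : k ^+ 2 / (4 * c) = (k / (2 * c)) ^+ 2 * c.
    by field; rewrite gt_eqF.
  have sq : 0 <= c * (d - k / (2 * c)) ^+ 2 by rewrite mulr_ge0 ?sqr_ge0// ltW.
  have sqE : c * (d - k / (2 * c)) ^+ 2 = c * d ^+ 2 - k * d + k ^+ 2 / (4 * c).
    by field; rewrite gt_eqF.
  have tk : t * (k * d) = 1 + t * (c * d * (t * d)).
    have -> : t * (k * d) = k * (t * d) by ring.
    have -> : t * (c * d * (t * d)) = c * (t * d) * (t * d) by ring.
    by rewrite td kdef; field; rewrite gt_eqF.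
  clearbody t d; rewrite -(ler_pM2l t0).
  have : t * (c * (d - k / (2 * c)) ^+ 2) >= 0 by rewrite mulr_ge0// ltW.
  rewrite sqE.
  nra.
pose m := inf (h @` D).
have hm : has_inf (h @` D).
  by split; [exists (h x0), x0|exists m0 => _ [x Dx <-]; exact: m0h].
have m_le x : D x -> m <= h x by move=> Dx; apply: (ge_inf hm.2); exists x.
have /choice[x_ x_P] : forall n : nat, exists x, D x /\ h x < m + n.+1%:R^-1.
  move=> n; have [|_ [x Dx <-] hx] := @inf_adherent _ (h @` D) n.+1%:R^-1 _ hm.
    by rewrite invr_gt0.
  by exists x.
have x_h n N : (N <= n)%N -> h (x_ n) < m + N.+1%:R^-1.
  move=> Nn; apply: lt_le_trans (x_P n).2 _; rewrite lerD2l.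
  by rewrite lef_pV2 ?posrE// ler_nat.
have x_cvg : cvg (x_ @ \oo).
  apply/cauchy_cvgP/cauchy_exP => e e0.
  have e2 : 0 < c * e ^+ 2 / 4 by rewrite divr_gt0// mulr_gt0// exprn_gt0.
  have [N Ne] : exists N : nat, N.+1%:R^-1 < c * e ^+ 2 / 4.
    exact: filter_ex (near_infty_natSinv_lt (PosNum e2)).
  exists (x_ N); exists N => // n /= Nn; rewrite -ball_normE /=.
  rewrite -(@ltr_pXn2r _ 2)// ?nnegrE ?(ltW e0)//.
  have half1 : 2^-1 < 1 :> R by lra.
  have half0 : 0 < 2^-1 :> R by lra.
  have := hconv _ _ _ (x_P N).1 (x_P n).1 half0 half1.
  have := m_le _ (Dconv _ _ _ (x_P N).1 (x_P n).1 half0 half1).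
  have := x_h n N Nn; have := x_h N N (leqnn _).
  have -> : 2^-1 * (1 - 2^-1) * c * `|x_ N - x_ n| ^+ 2 =
    c * (`|x_ N - x_ n| ^+ 2 / 4) by field.
  move=> h1 h2 h3 h4.
  have : c * (`|x_ N - x_ n| ^+ 2 / 4) < c * (e ^+ 2 / 4).
    rewrite [ltRHS]mulrA; apply: le_lt_trans Ne.
    move: h3 h4 h1 h2; set z := h _; set d := c * _; set s := N.+1%:R^-1; lra.
  by rewrite ltr_pM2l// ltr_pM2r// invr_gt0.
have [p x_p] : exists p : X, x_ @ \oo --> p by exact/cvg_ex.
have pP N : D p /\ h p <= m + N.+1%:R^-1.
  apply: (closed_cvg _ (hcl (m + N.+1%:R^-1)) _ _ x_p).
  by exists N => // n /= Nn; split; [exact: (x_P n).1|exact/ltW/x_h].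
exists p; first exact: (pP 0%N).1.
move=> x Dx; apply: le_trans (m_le x Dx).
apply/ler_addgt0Pr => e e0.
have /filter_ex[N /= Ne] := near_infty_natSinv_lt (PosNum e0).
by apply: le_trans (pP N).2 _; rewrite lerD2l ltW.
Qed.

(** * Gradient inequalities *)

Section gradient.
Context {R : realType} {X : completeNormedModType R}.
Implicit Types (h : X -> R) (x y v : X).

Lemma grad_right_cvg h y v : derivable (h : X -> R^o) y v ->
  t^-1 * (h (t *: v + y) - h y) @[t --> 0^'+] --> grad h y v.
Proof. by move=> dh; apply: cvg_dnbhs_at_right; exact: dh. Qed.

Lemma grad_le h y v (a c : R) : derivable (h : X -> R^o) y v ->
  (forall t : R, 0 < t -> t < 1 -> h (t *: v + y) - h y <= t * (a - (1 - t) * c)) ->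
  grad h y v <= a - c.
Proof.
move=> /grad_right_cvg dh hle.
have ac : (a - (1 - t) * c) @[t --> 0^'+] --> a - c.
  apply: cvg_at_right_filter; rewrite -[in a - c](mul1r c) -{2}(subr0 1).
  apply: cvgB; first exact: cvg_cst.
  by apply: cvgMl; apply: cvgB; [exact: cvg_cst|exact: cvg_id].
apply: ler_cvg_to dh ac _; near=> t.
have t0 : 0 < t by near: t; exact: nbhs_right_gt.
have t1 : t < 1 by near: t; exact: nbhs_right_lt.
by rewrite ler_pdivrMl//; exact: hle.
Unshelve. all: by end_near. Qed.

Lemma grad_ge h y v (a : R) : derivable (h : X -> R^o) y v ->
  (forall t : R, 0 < t -> t < 1 -> t * a <= h (t *: v + y) - h y) ->
  a <= grad h y v.
Proof.
move=> /grad_right_cvg dh hge.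
apply: ler_cvg_to (cvg_cst a) dh _; near=> t.
have t0 : 0 < t by near: t; exact: nbhs_right_gt.
have t1 : t < 1 by near: t; exact: nbhs_right_lt.
by rewrite ler_pdivlMl//; exact: hge.
Unshelve. all: by end_near. Qed.

(** Letting the weight of [x] tend to 0 in the inequality of relative uniform
    convexity leaves the whole modulus [c] in the first-order inequality. *)
Lemma gradient_inequality h x y (c : R) :
  gateaux_differentiable h y ->
  (forall t : R, 0 < t -> t < 1 ->
    h (t *: x + (1 - t) *: y) + t * (1 - t) * c <= t * h x + (1 - t) * h y) ->
  c <= h x - h y - grad h y (x - y).
Proof.
move=> [dh _] hc; rewrite lerBrDr -lerBrDl; apply: grad_le => // t t0 t1.
by have := hc t t0 t1; rewrite convE; nra.
Qed.

(** The descent lemma along one segment, where only a Lipschitz bound for the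
    directional derivative along that segment is needed. *)
Lemma segment_descent h x y (M : R) :
  (forall t : R, 0 <= t -> t <= 1 ->
    derivable (h : X -> R^o) (t *: (x - y) + y) (x - y)) ->
  (forall t : R, 0 <= t -> t <= 1 ->
    grad h (t *: (x - y) + y) (x - y) - grad h y (x - y) <= 2 * t * M) ->
  h x <= h y + grad h y (x - y) + M.
Proof.
set v := x - y => dh hM.
pose phi : R -> R^o := fun t => h (t *: v + y).
have phi_derive (t : R) : 0 <= t -> t <= 1 -> is_derive t 1 phi (grad h (t *: v + y) v).
  move=> t0 t1; have H := dh t t0 t1.
  have E : (fun s : R => s^-1 *: ((phi \o shift t) (s *: 1) - phi t)) =
      (fun s : R => s^-1 *: (((h : X -> R^o) \o shift (t *: v + y)) (s *: v)
                          - h (t *: v + y))).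
    apply/funext => s; congr (_ *: (_ - _)); rewrite /phi /= /shift/=.
    by rewrite scalerDl addrA /GRing.scale/= mulr1.
  by split; [rewrite /derivable E|rewrite /derive E].
pose q : R -> R^o :=
  (grad h y v) \*: (id : R -> R^o) + M \*: ((id : R -> R^o) ^+ 2).
have q_derive (t : R) : is_derive t 1 q (grad h y v + 2 * t * M).
  apply: is_derive_eq; rewrite /GRing.scale/= !mulr1 expr1; ring.
have psi_derive (t : R) : 0 <= t -> t <= 1 ->
    is_derive t 1 (phi - q) (grad h (t *: v + y) v - (grad h y v + 2 * t * M)).
  by move=> t0 t1; have := phi_derive t t0 t1 => ?; exact: is_deriveB.
have [||c] := @MVT R (phi - q)
    (fun t : R => grad h (t *: v + y) v - (grad h y v + 2 * t * M)) 0 1 ltr01.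
- by move=> t; rewrite in_itv/= => /andP[t0 t1]; apply: psi_derive; exact: ltW.
- apply: derivable_within_continuous => t; rewrite in_itv/= => /andP[t0 t1].
  by have [] := psi_derive t t0 t1.
rewrite in_itv/= subr0 mulr1 => /andP[c0 c1].
rewrite -[(phi - q) 1]/(phi 1 - q 1) -[(phi - q) 0]/(phi 0 - q 0).
have qE t : q t = grad h y v * t + M * t ^+ 2 by [].
rewrite !qE /phi scale1r scale0r add0r subrK.
have := hM c (ltW c0) (ltW c1); lra.
Qed.

Lemma dual_norm_bound (l : X -> R) (c : R) v : dual l -> 0 <= c ->
  (dual_norm l <= c%:E)%E -> `|l v| <= c * `|v|.
Proof.
move=> dl c0 lc; have [->|v0] := eqVneq v 0.
  by rewrite dual0// !normr0 mulr0.
have v_gt0 : 0 < `|v| by rewrite normr_gt0.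
rewrite -ler_pdivrMr// -[X in _ / X]normr_id -normrV ?unitfE ?gt_eqF//.
rewrite -normrM mulrC -(dualZ _ _ dl) -lee_fin; apply: le_trans lc.
apply: ereal_sup_ubound; exists (`|v|^-1 *: v) => //=.
by rewrite normrZ normfV normr_id mulVf// gt_eqF.
Qed.

Lemma lipschitz_grad_bound h (A : set X) (L : R) x y v :
  lipschitz_grad h A -> lip_const h A <= L ->
  gateaux_differentiable h x -> gateaux_differentiable h y -> A x -> A y ->
  `|grad h x v - grad h y v| <= L * `|x - y| * `|v|.
Proof.
move=> [c0 hc0] lipL [_ dx] [_ dy] Ax Ay.
have dxy : dual (fun w => grad h x w - grad h y w).
  split=> [a u w|w].
    by rewrite /grad (dualD _ _ dx) (dualD _ _ dy) (dualZ _ _ dx) (dualZ _ _ dy); ring.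
  by apply: cvgB; [exact: dx.2|exact: dy.2].
have hinf : has_inf [set c | lipschitz_grad_with h A c].
  by split; [exists c0; exact: hc0|exists 0 => c []].
have : forall e : R, 0 < e ->
    `|grad h x v - grad h y v| <= (L + e) * `|x - y| * `|v|.
  move=> e e0; have [c [c_ge0 hc] ce] := inf_adherent e0 hinf.
  have H := dual_norm_bound v dxy (mulr_ge0 c_ge0 (normr_ge0 _)) (hc x y Ax Ay).
  apply: le_trans H _; rewrite ler_wpM2r// ler_wpM2r//.
  by apply: ltW; apply: lt_le_trans ce _; rewrite lerD2r.
set d := `|_|; set k := `|x - y|; set n := `|v| => H.
apply/ler_addgt0Pr => e e0; have kn : 0 <= k * n by rewrite mulr_ge0 ?normr_ge0.
have kn1 : 0 < k * n + 1 by rewrite ltr_wpDl.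
have := H _ (divr_gt0 e0 kn1).
have : e / (k * n + 1) * (k * n) <= e.
  rewrite mulrAC ler_pdivrMr// ler_pM2l//; lra.
by rewrite -mulrA; nra.
Qed.

(** The segment from [y] to [x] stays in the convex set, where the increment of
    the gradient is at most [L] times the distance to [y]. *)
Lemma descent h (A : set X) (L : R) x y : segment_closed A ->
  lipschitz_grad h A -> lip_const h A <= L ->
  (forall z, A z -> gateaux_differentiable h z) -> A x -> A y ->
  h x <= h y + grad h y (x - y) + L / 2 * `|x - y| ^+ 2.
Proof.
move=> Aconv lipA lipL dA Ax Ay.
have Aseg (t : R) : 0 <= t -> t <= 1 -> A (t *: (x - y) + y).
  rewrite le_eqVlt => /predU1P[<- _|t0]; first by rewrite scale0r add0r.
  rewrite le_eqVlt => /predU1P[->|t1]; first by rewrite scale1r subrK.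
  by rewrite -convE; exact: Aconv.
apply: segment_descent => t t0 t1; first exact: (dA _ (Aseg t t0 t1)).1.
have At := Aseg t t0 t1.
have := lipschitz_grad_bound (x - y) lipA lipL (dA _ At) (dA _ Ay) At Ay.
rewrite addrK normrZ ger0_norm// => H.
apply: le_trans (ler_norm _) _; apply: le_trans H _.
have -> : 2 * t * (L / 2 * `|x - y| ^+ 2) = L * (t * `|x - y|) * `|x - y|.
  by field.
exact: lexx.
Qed.

End gradient.

(** * Bregman divergences *)

Section bregman_divergence.
Context {R : realType} {X : completeNormedModType R}.
Variables (b : X -> \bar R) (U : set X).
Hypothesis b_bregman : semi_bregman b U.

Definition bregman_div (x y : X) : R :=
  fine (b x) - fine (b y) - egrad b y (x - y).

Lemma zone_edom y : U y -> edom b y.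
Proof. by have [[-> _ _] _ _ _ _] := b_bregman; exact: interior_subset. Qed.

Lemma edom_fine x : edom b x -> b x = (fine (b x))%:E.
Proof.
by have [[_ _ boo] _ _ _ _] := b_bregman => xb; rewrite fineK// fin_real// boo.
Qed.

Lemma edom_segment : segment_closed (edom b).
Proof.
have [_ _ bconv _ _] := b_bregman.
move=> x y t xb yb t0 t1; have := bconv x y t I I t0 t1 => /le_lt_trans; apply.
by rewrite (edom_fine xb) (edom_fine yb) -!EFinM -EFinD ltry.
Qed.

Lemma fine_convex x y (t : R) : edom b x -> edom b y -> 0 < t -> t < 1 ->
  fine (b (t *: x + (1 - t) *: y)) <= t * fine (b x) + (1 - t) * fine (b y).
Proof.
have [_ _ bconv _ _] := b_bregman.
move=> xb yb t0 t1; have := bconv x y t I I t0 t1.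
rewrite (edom_fine (edom_segment xb yb t0 t1)) (edom_fine xb) (edom_fine yb).
by rewrite -!EFinM -EFinD lee_fin.
Qed.

(** An interior point of a convex set sees all of it through the interior. *)
Lemma zone_segment x y (t : R) : edom b x -> U y -> 0 <= t -> t < 1 ->
  U (t *: x + (1 - t) *: y).
Proof.
have [[UE _ _] _ _ _ _] := b_bregman.
move=> xb Uy; rewrite le_eqVlt => /predU1P[<- _|t0 t1].
  by rewrite scale0r add0r subr0 scale1r.
move: Uy; rewrite UE => /nbhs_ballP[r /= r0 yr]; apply/nbhs_ballP.
have t10 : 0 < 1 - t by rewrite subr_gt0.
exists ((1 - t) * r); first exact: mulr_gt0.
move=> w; rewrite -ball_normE /= => wr.
pose y' := y + (1 - t)^-1 *: (w - (t *: x + (1 - t) *: y)).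
have -> : w = t *: x + (1 - t) *: y'.
  rewrite scalerDr scalerA divff ?gt_eqF// scale1r addrA.
  by rewrite [RHS]addrC subrK.
apply: edom_segment => //; apply: yr; rewrite -ball_normE /=.
rewrite opprD addrA subrr sub0r normrN normrZ gtr0_norm ?invr_gt0//.
by rewrite ltr_pdivrMl// distrC.
Qed.

Lemma zone_gateaux y : U y -> gateaux_differentiable (fine \o b) y.
Proof. by have [_ H _ _ _] := b_bregman; exact: H. Qed.

Lemma zone_dual y : U y -> dual (egrad b y).
Proof. by move=> /zone_gateaux[]. Qed.

Lemma divergenceE x y : edom b x -> U y ->
  divergence b U x y = (bregman_div x y)%:E.
Proof.
move=> xb Uy; rewrite /divergence !mem_set//= (edom_fine xb).
by rewrite (edom_fine (zone_edom Uy)).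
Qed.

Lemma bregman_div_ge x y (c : R) : edom b x -> U y ->
  (forall t, 0 < t -> t < 1 ->
    fine (b (t *: x + (1 - t) *: y)) + t * (1 - t) * c
      <= t * fine (b x) + (1 - t) * fine (b y)) ->
  c <= bregman_div x y.
Proof.
by move=> xb Uy hc; apply: gradient_inequality => //; exact: zone_gateaux.
Qed.

Lemma bregman_div_ge0 x y : edom b x -> U y -> 0 <= bregman_div x y.
Proof.
move=> xb Uy; apply: bregman_div_ge => // t t0 t1.
by rewrite mulr0 addr0 fine_convex//; exact: zone_edom.
Qed.

Lemma bregman_div_eq0 x y : edom b x -> U y -> bregman_div x y = 0 -> x = y.
Proof.
have [_ _ _ _ bstrict] := b_bregman.
move=> xb Uy xy0; apply: contrapT => xy; have yb := zone_edom Uy.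
(* Strict convexity at the midpoint would make the divergence of the midpoint
   negative. *)
have h0 : 0 < 2^-1 :> R by lra.
have h1 : 2^-1 < 1 :> R by lra.
have mb := edom_segment xb yb h0 h1.
have := bregman_div_ge0 mb Uy.
have := bstrict x y 2^-1 xb yb xy h0 h1.
rewrite (edom_fine mb) (edom_fine xb) (edom_fine yb) -!EFinM -EFinD lte_fin.
move: xy0; rewrite /bregman_div convE addrK (dualZ _ _ (zone_dual Uy)).
by set z := fine (b (_ + _)); set e := egrad _ _ _; lra.
Qed.

Lemma bregman_div_refl y : U y -> bregman_div y y = 0.
Proof.
by move=> Uy; rewrite /bregman_div !subrr (dual0 (zone_dual Uy)) subr0.
Qed.

Lemma bregman_three_point x p y : U p -> U y ->
  bregman_div x y - bregman_div x p - bregman_div p y =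
  egrad b p (x - p) - egrad b y (x - p).
Proof.
move=> Up Uy; rewrite /bregman_div.
have -> : egrad b y (x - y) = egrad b y (x - p) + egrad b y (p - y).
  by rewrite -(dualD _ _ (zone_dual Uy)) addrA subrK.
by ring.
Qed.

(** An infinite value of the gauge admits every real modulus [c], so nothing is
    lost by passing to real values. *)
Lemma uniformly_convex_rel_real (S1 S2 : set X) (psi : R -> \bar R)
    (x y : X) (c t : R) :
  uniformly_convex_rel b S1 S2 psi -> S1 x -> S2 y -> 0 < t -> t < 1 ->
  (c%:E <= psi `|x - y|%R)%E ->
  fine (b (t *: x + (1 - t) *: y)) + t * (1 - t) * c
    <= t * fine (b x) + (1 - t) * fine (b y).
Proof.
move=> [[_ _ S1b S2b] psi_ge0 _ hpsi] S1x S2y t0 t1 cpsi.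
have xb := S1b _ S1x; have yb := S2b _ S2y.
have tt0 : 0 < t * (1 - t) by rewrite mulr_gt0// subr_gt0.
have := hpsi t x y t0 t1 S1x S2y.
rewrite (edom_fine (edom_segment xb yb t0 t1)) (edom_fine xb) (edom_fine yb).
rewrite -!EFinM -EFinD => H; rewrite -lee_fin; apply: le_trans H.
rewrite EFinD leeD2l// EFinM.
by apply: lee_wpmul2l; rewrite ?lee_fin// ltW.
Qed.

End bregman_divergence.

(** * The proximal step *)

Section proximal_step.
Context {R : realType} {X : completeNormedModType R}.
Variables (b : X -> \bar R) (U : set X) (C : set X).
Variables (f : X -> R) (g : X -> \bar R).
Hypothesis b_bregman : semi_bregman b U.
Hypothesis C_feasible : feasible_set b U C.
Hypothesis f_smooth : smooth_part b U C f.
Hypothesis g_nonsmooth : nonsmooth_part C g.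

Let D := bregman_div b.

Lemma feasible_edom x : C x -> edom b x.
Proof. by have [H _ _ _ _] := C_feasible; exact: H. Qed.

Lemma feasible_segment : segment_closed C.
Proof. by have [_ _ /convex_set_segment] := C_feasible. Qed.

Lemma smooth_dual y : U y -> dual (grad f y).
Proof. by have [_ H _] := f_smooth => /H[]. Qed.

Lemma smooth_convex x y (t : R) : C x -> C y -> 0 < t -> t < 1 ->
  f (t *: x + (1 - t) *: y) <= t * f x + (1 - t) * f y.
Proof.
have [fconv _ _] := f_smooth; move=> Cx Cy t0 t1.
have := fconv (Itv01 (ltW t0) (ltW t1)) x y.
by rewrite !mem_set//; [exact|exact: feasible_edom|exact: feasible_edom].
Qed.

Lemma smooth_gradient_inequality x y : C x -> C y -> U y ->
  f y + grad f y (x - y) <= f x.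
Proof.
have [_ df _] := f_smooth; move=> Cx Cy Uy.
suff : 0 <= f x - f y - grad f y (x - y) by lra.
apply: gradient_inequality; first exact: df.
by move=> t t0 t1; rewrite mulr0 addr0; exact: smooth_convex.
Qed.

Lemma nonsmooth_gtNy x : C x -> (-oo < g x)%E.
Proof. by have [_ [H _] _] := g_nonsmooth; exact: H. Qed.

Lemma nonsmooth_fine x : C x -> (g x < +oo)%E -> g x = (fine (g x))%:E.
Proof. by move=> Cx gx; rewrite fineK// fin_real// nonsmooth_gtNy. Qed.

Lemma nonsmooth_convex_lty x y (t : R) : C x -> C y -> 0 < t -> t < 1 ->
  (g x < +oo)%E -> (g y < +oo)%E -> (g (t *: x + (1 - t) *: y)%R < +oo)%E.
Proof.
have [gconv _ _] := g_nonsmooth; move=> Cx Cy t0 t1 gx gy.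
apply: le_lt_trans (gconv x y t Cx Cy t0 t1) _.
by rewrite (nonsmooth_fine Cx)// (nonsmooth_fine Cy)// -!EFinM -EFinD ltry.
Qed.

Lemma nonsmooth_convex x y (t : R) : C x -> C y -> 0 < t -> t < 1 ->
  (g x < +oo)%E -> (g y < +oo)%E ->
  fine (g (t *: x + (1 - t) *: y)) <= t * fine (g x) + (1 - t) * fine (g y).
Proof.
have [gconv _ _] := g_nonsmooth; move=> Cx Cy t0 t1 gx gy.
have Cxy := feasible_segment Cx Cy t0 t1.
have gxy := nonsmooth_convex_lty Cx Cy t0 t1 gx gy.
have := gconv x y t Cx Cy t0 t1.
rewrite (nonsmooth_fine Cxy gxy) (nonsmooth_fine Cx gx) (nonsmooth_fine Cy gy).
by rewrite -!EFinM -EFinD lee_fin.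
Qed.

Lemma objectiveE x : C x -> (g x < +oo)%E ->
  objective C f g x = (f x + fine (g x))%:E.
Proof.
by move=> Cx gx; rewrite /objective mem_set// (nonsmooth_fine Cx gx).
Qed.

Definition prox_model_real (L mu : R) (x y : X) : R :=
  f y + grad f y (x - y) + L / mu * D x y + fine (g x).

Lemma prox_modelE (L mu : R) x y : C x -> U y -> (g x < +oo)%E ->
  prox_model b U f g L mu x y = (prox_model_real L mu x y)%:E.
Proof.
move=> Cx Uy gx; rewrite /prox_model (divergenceE b_bregman)//.
  by rewrite (nonsmooth_fine Cx gx).
exact: feasible_edom.
Qed.

Lemma prox_model_infty (L mu : R) x y : C x -> U y -> g x = +oo%E ->
  prox_model b U f g L mu x y = +oo%E.
Proof.
move=> Cx Uy gx; rewrite /prox_model (divergenceE b_bregman)//.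
  by rewrite gx -EFinM -!EFinD addey.
exact: feasible_edom.
Qed.

Section one_step.
Variables (S : set X) (L mu : R) (y : X).
Hypothesis SC : S `<=` C.
Hypothesis S_closed : closed S.
Hypothesis S_segment : segment_closed S.
Hypothesis S_proper : exists2 x, S x & (g x < +oo)%E.
Hypothesis b_strong : strongly_convex_on b S mu.
Hypothesis L0 : 0 < L.
Hypothesis Uy : U y.

Let mu0 : 0 < mu. Proof. by have [] := b_strong. Qed.
Let c0 : 0 < L / mu. Proof. exact: divr_gt0. Qed.

Lemma strongly_convex_real x x' (t : R) : S x -> S x' -> 0 < t -> t < 1 ->
  fine (b (t *: x + (1 - t) *: x')) + t * (1 - t) * (2^-1 * mu * `|x - x'| ^+ 2)
    <= t * fine (b x) + (1 - t) * fine (b x').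
Proof.
have [_ bS] := b_strong => Sx Sx' t0 t1.
exact: (uniformly_convex_rel_real b_bregman bS).
Qed.

Lemma prox_model_lsc : lsc_within S (fun x => prox_model b U f g L mu x y).
Proof.
have [_ _ _ lscb _] := b_bregman; have [_ _ lscg] := g_nonsmooth.
pose aff x := f y + grad f y (x - y) - L / mu * fine (b y)
  - L / mu * egrad b y (x - y).
have aff_cont : continuous aff.
  have cont_dual l : dual l -> continuous (fun x : X => l (x - y)).
    move=> dl x; apply: (@continuous_comp _ _ _ (fun x => x - y) l).
      by apply: cvgB; [exact: cvg_id|exact: cvg_cst].
    exact: dl.2.
  move=> x; apply: cvgB; first apply: cvgB; first apply: cvgD.
  - exact: cvg_cst.
  - by apply: cont_dual; exact: smooth_dual.
  - exact: cvg_cst.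
  - apply: cvgMr; apply: cont_dual; exact: zone_dual b_bregman _ Uy.
have H : lsc_within S (fun x => ((aff x)%:E + ((L / mu)%:E * b x + g x))%E).
  apply: lsc_withinD.
  - by move=> x Sx; rewrite ltNyr.
  - move=> x Sx; have Cx := SC Sx.
    rewrite (edom_fine b_bregman (feasible_edom Cx)) -EFinM.
    by have := nonsmooth_gtNy Cx; case: (g x) => [r _|_|] //; rewrite -?EFinD ?ltNyr.
  - exact: lsc_within_continuous.
  - apply: lsc_withinD.
    + move=> x Sx; rewrite (edom_fine b_bregman (feasible_edom (SC Sx))).
      by rewrite -EFinM ltNyr.
    + by move=> x Sx; rewrite nonsmooth_gtNy//; exact: SC.
    + by apply: lsc_within_scale => //; exact: lsc_within_lsc.
    + exact: lsc_withinS SC (lsc_on_within lscg).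
have E x : S x -> ((aff x)%:E + ((L / mu)%:E * b x + g x))%E =
    prox_model b U f g L mu x y.
  move=> Sx; rewrite /prox_model (divergenceE b_bregman (feasible_edom (SC Sx)))//.
  rewrite (edom_fine b_bregman (feasible_edom (SC Sx))) addeA -!EFinM -!EFinD.
  by congr (_%:E + _)%E; rewrite /aff /bregman_div /=; ring.
move=> x Sx a; rewrite -E// => /(H x Sx); apply: filterS => z Hz Sz.
by rewrite -E//; exact: Hz.
Qed.

Lemma prox_minimizer_exists : exists p, S p /\
  forall x, S x -> (prox_model b U f g L mu p y <= prox_model b U f g L mu x y)%E.
Proof.
pose A := [set x | S x /\ (g x < +oo)%E].
(* The modulus is [L / mu] times [mu / 2]. *)
have [|||||p [Sp gp] pmin] := @strongly_convex_minimizer R X A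
    (fun x => prox_model_real L mu x y) (L / 2).
- by rewrite divr_gt0.
- by have [x Sx gx] := S_proper; exists x.
- move=> x x' t [Sx gx] [Sx' gx'] t0 t1; split; first exact: S_segment.
  by apply: nonsmooth_convex_lty => //; exact: SC.
- move=> x x' t [Sx gx] [Sx' gx'] t0 t1.
  have := nonsmooth_convex (SC Sx) (SC Sx') t0 t1 gx gx'.
  have := strongly_convex_real Sx Sx' t0 t1; rewrite -(ler_pM2l c0).
  rewrite /prox_model_real /D /bregman_div.
  have affE l : dual l -> l (t *: x + (1 - t) *: x' - y) =
      t * l (x - y) + (1 - t) * l (x' - y).
    by move=> dl; rewrite !(dualB _ _ dl) (dualD _ _ dl) !(dualZ _ _ dl); ring.
  rewrite (affE _ (smooth_dual Uy)) (affE _ (zone_dual b_bregman Uy)).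
  have -> : L / 2 = L / mu * (2^-1 * mu) by field; rewrite gt_eqF.
  set r := L / mu; set n := `|_|; set u := fine (b (_ + _)).
  by set w := fine (g (_ + _)); lra.
- move=> a; have -> : [set x | A x /\ prox_model_real L mu x y <= a] =
      [set x | S x /\ (prox_model b U f g L mu x y <= a%:E)%E].
    apply/seteqP; split=> x /=.
      by move=> [[Sx gx] xa]; rewrite (prox_modelE L mu (SC Sx) Uy gx) lee_fin.
    move=> [Sx]; have [gx|] := eqVneq (g x) +oo%E.
      by rewrite prox_model_infty//; exact: SC.
    by rewrite -ltey => gx; rewrite (prox_modelE L mu (SC Sx) Uy gx) lee_fin.
  exact: lsc_within_sublevel_closed S_closed prox_model_lsc.
exists p; split=> // x Sx; rewrite prox_modelE//; last exact: SC.
have [gx|] := eqVneq (g x) +oo%E.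
  by rewrite prox_model_infty ?leey//; exact: SC.
by rewrite -ltey => gx; rewrite prox_modelE ?lee_fin ?pmin//; exact: SC.
Qed.

Let p := prox b U f g L mu S y.

Lemma proxP : S p /\
  forall x, S x -> (prox_model b U f g L mu p y <= prox_model b U f g L mu x y)%E.
Proof. exact: (getPex prox_minimizer_exists). Qed.

Lemma prox_lty : (g p < +oo)%E.
Proof.
have [Sp pmin] := proxP; rewrite ltey; apply/eqP => gp.
have [x Sx gx] := S_proper; have := pmin x Sx.
by rewrite prox_model_infty// ?prox_modelE//; exact: SC.
Qed.

(** Comparing [p] with the points of the segment towards [x] gives the
    first-order optimality condition of the step. *)
Lemma prox_variational x : U p -> S x -> (g x < +oo)%E ->
  0 <= grad f y (x - p) + L / mu * (egrad b p (x - p) - egrad b y (x - p))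
       + fine (g x) - fine (g p).
Proof.
move=> Up Sx gx; have [Sp pmin] := proxP; have gp := prox_lty.
(* [a] is the value of [egrad b p (x - p)] at which the claim is an
   equality. *)
pose a := egrad b y (x - p)
  - (L / mu)^-1 * (grad f y (x - p) + fine (g x) - fine (g p)).
have : a <= egrad b p (x - p).
  apply: grad_ge; first exact: (zone_gateaux b_bregman Up).1.
  move=> t t0 t1; rewrite -convE -(ler_pM2l c0).
  have Sq := S_segment Sx Sp t0 t1; have Cq := SC Sq.
  have gq := nonsmooth_convex_lty (SC Sx) (SC Sp) t0 t1 gx gp.
  have := pmin _ Sq; have := nonsmooth_convex (SC Sx) (SC Sp) t0 t1 gx gp.
  rewrite !prox_modelE//; last exact: SC.
  rewrite lee_fin /prox_model_real /D /bregman_div /=.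
  have affE l : dual l -> l (t *: x + (1 - t) *: p - y) =
      l (p - y) + t * l (x - p).
    by move=> dl; rewrite !(dualB _ _ dl) (dualD _ _ dl) !(dualZ _ _ dl); ring.
  rewrite (affE _ (smooth_dual Uy)) (affE _ (zone_dual b_bregman Uy)) /a.
  have -> : L / mu * (t * (egrad b y (x - p)
      - (L / mu)^-1 * (grad f y (x - p) + fine (g x) - fine (g p)))) =
    t * (L / mu * egrad b y (x - p))
      - t * (grad f y (x - p) + fine (g x) - fine (g p)).
    by field; rewrite !gt_eqF.
  set r := L / mu; set u := fine (b (_ + _)).
  by set w := fine (g (_ + _)); lra.
rewrite -(ler_pM2l c0) /a mulrBr mulrA divff ?gt_eqF// mul1r; lra.
Qed.

(** The basic estimate: a step that satisfies the sufficient-decrease test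
    makes up in the Bregman distance to any [x] what it lacks in the
    objective. *)
Lemma prox_step_estimate x : C y -> U p -> S x -> (g x < +oo)%E ->
  (objective C f g p <= prox_model b U f g L mu p y)%E ->
  f p + fine (g p) - (f x + fine (g x)) <= L / mu * (D x y - D x p).
Proof.
move=> Cy Up Sx gx; have [Sp _] := proxP; have gp := prox_lty.
have Cp := SC Sp; have Cx := SC Sx.
rewrite objectiveE// prox_modelE// lee_fin /prox_model_real.
have := prox_variational Up Sx gx.
have := smooth_gradient_inequality Cx Cy Uy.
have := bregman_three_point b_bregman x Up Uy; rewrite -/D => <-.
have -> : grad f y (x - y) = grad f y (x - p) + grad f y (p - y).
  by rewrite -(dualD _ _ (smooth_dual Uy)) addrA subrK.
rewrite /D; set r := L / mu; lra.
Qed.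

(** Under the Lipschitz rule the sufficient-decrease test holds: the descent
    lemma costs [L / 2] times the squared distance, which strong convexity of
    [b] pays for. *)
Lemma lipschitz_sufficient_decrease : lipschitz_grad f (S `&` U) ->
  lip_const f (S `&` U) <= L -> S y -> U p ->
  (objective C f g p <= prox_model b U f g L mu p y)%E.
Proof.
move=> lipS lipL Sy Up; have [Sp _] := proxP; have gp := prox_lty.
have [_ df _] := f_smooth.
rewrite objectiveE ?prox_modelE ?lee_fin//; try exact: SC.
rewrite lerD2r.
have SU_segment : segment_closed (S `&` U).
  move=> u v t [Su Uu] [Sv Uv] t0 t1; split; first exact: S_segment.
  by apply: (zone_segment b_bregman) => //; [exact: (zone_edom b_bregman Uu)|exact: ltW].
have := descent SU_segment lipS lipL (fun z => df z \o snd) (conj Sp Up) (conj Sy Uy).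
move=> /le_trans; apply; rewrite lerD2l.
have : 2^-1 * mu * `|p - y| ^+ 2 <= D p y.
  apply: (bregman_div_ge b_bregman) => //; first exact/feasible_edom/SC.
  by move=> t t0 t1; exact: strongly_convex_real.
rewrite -(ler_pM2l c0); apply: le_trans.
rewrite le_eqVlt; apply/orP; left; apply/eqP.
by field; rewrite gt_eqF.
Qed.

End one_step.

End proximal_step.

(** * Quadratic growth of the modulus of uniform convexity *)

Section uniform_convexity_growth.
Context {R : realType} {X : completeNormedModType R}.
Variables (b : X -> \bar R) (U : set X).
Hypothesis b_bregman : semi_bregman b U.

Let h x : R := fine (b x).

(** A given gauge of uniform convexity need not grow, only the best one does.
    Recording all the admissible values at a distance [t] gives access to the
    best one while staying in the reals: every value is admissible when no two
    points of the zone are at that distance. *)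
Definition gauge_value (t m : R) : Prop := 0 <= m /\
  forall x y (lam : R), U x -> U y -> `|x - y| = t -> 0 < lam -> lam < 1 ->
    h (lam *: x + (1 - lam) *: y) + lam * (1 - lam) * m
      <= lam * h x + (1 - lam) * h y.

Lemma gauge_value_half t m : 0 <= m ->
  (forall x y (lam : R), U x -> U y -> `|x - y| = t -> 0 < lam -> lam <= 2^-1 ->
    h (lam *: x + (1 - lam) *: y) + lam * (1 - lam) * m
      <= lam * h x + (1 - lam) * h y) -> gauge_value t m.
Proof.
move=> m0 H; split=> // x y lam Ux Uy xyt lam0 lam1.
have [lam_le|lam_gt] := leP lam 2^-1; first exact: H.
have yxt : `|y - x| = t by rewrite distrC.
have lam10 : 0 < 1 - lam by lra.
have lam1le : 1 - lam <= 2^-1 by lra.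
have := H y x (1 - lam) Uy Ux yxt lam10 lam1le.
by rewrite subKr addrC [_ *: y + _]addrC; lra.
Qed.

Lemma zone_convex x y (t : R) : edom b x -> U y -> 0 <= t -> t < 1 ->
  h (t *: x + (1 - t) *: y) <= t * h x + (1 - t) * h y.
Proof.
move=> xb Uy; rewrite le_eqVlt => /predU1P[<- _|t0 t1].
  by rewrite scale0r add0r subr0 scale1r mul0r add0r mul1r.
by apply: (fine_convex b_bregman) => //; exact: (zone_edom b_bregman Uy).
Qed.

(** The largest admissible value [M] at distance [c * t] can be improved, by
    combining it with [m] at the intermediate point at distance [t], as long as
    it is smaller than [c ^+ 2 * m]. *)
Lemma gauge_value_dilate (c t m : R) : 1 <= c -> c < 2 -> gauge_value t m ->
  gauge_value (c * t) (c ^+ 2 * m).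
Proof.
rewrite le_eqVlt => /predU1P[<- _|c1 c2 [m0 hm]].
  by rewrite mul1r expr1n mul1r.
have c0 : 0 < c by lra.
have c2m0 : 0 <= c ^+ 2 * m by rewrite mulr_ge0// sqr_ge0.
apply: contrapT => notc2m.
pose E := [set m' | gauge_value (c * t) m'].
have E0 : E 0.
  split=> // x y lam Ux Uy _ lam0 lam1; rewrite mulr0 addr0.
  by apply: zone_convex => //; [exact: (zone_edom b_bregman Ux)|exact: ltW].
have Edown m1 m2 : 0 <= m1 -> m1 <= m2 -> E m2 -> E m1.
  move=> m10 m12 [_ Em2]; split=> // x y lam Ux Uy xyt lam0 lam1.
  apply: le_trans (Em2 x y lam Ux Uy xyt lam0 lam1); rewrite lerD2l.
  by apply: ler_wpM2l => //; rewrite mulr_ge0 ?subr_ge0// ltW.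
have Eub : ubound E (c ^+ 2 * m).
  by move=> m' Em'; rewrite leNgt; apply/negP => /ltW /(Edown _ _ c2m0)/(_ Em').
have hE : has_sup E by split; [exists 0|exists (c ^+ 2 * m)].
pose M := sup E.
have M0 : 0 <= M by apply: (ub_le_sup hE.2).
have Mle : M <= c ^+ 2 * m by apply: ge_sup => //; exists 0.
have EM : E M.
  split=> // x y lam Ux Uy xyt lam0 lam1; apply/ler_addgt0Pr => e e0.
  have [m' [_ Em'] Mm'] := sup_adherent e0 hE.
  have := Em' x y lam Ux Uy xyt lam0 lam1.
  have : lam * (1 - lam) <= 1 by nra.
  have : 0 < lam * (1 - lam) by rewrite mulr_gt0// subr_gt0.
  rewrite -/M in Mm' *; set k := lam * (1 - lam); nra.
(* The combination gains [(1 - c * lam) * gap] over [M], up to the factor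
   [lam]; for [lam <= 1 / 2] this is at least [(1 - c / 2) * gap]. *)
pose gap := c * m - M / c.
have gap0 : 0 <= gap.
  by rewrite subr_ge0 ler_pdivrMr// mulrAC -expr2.
have EgapM : E (M + (1 - c / 2) * gap).
  apply: gauge_value_half; first by rewrite addr_ge0// mulr_ge0//; lra.
  move=> x y lam Ux Uy xyt lam0 lam1.
  have ci0 : 0 < c^-1 by rewrite invr_gt0.
  have ci1 : c^-1 < 1 by rewrite invf_lt1.
  pose u := c^-1 *: x + (1 - c^-1) *: y.
  have Uu : U u.
    by apply: (zone_segment b_bregman) => //; [exact: (zone_edom b_bregman Ux)|exact: ltW].
  have uy : `|u - y| = t.
    by rewrite /u convE addrK normrZ gtr0_norm// xyt mulKf// gt_eqF.
  have clam0 : 0 < c * lam by rewrite mulr_gt0.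
  have clam1 : c * lam < 1 by nra.
  have := hm u y (c * lam) Uu Uy uy clam0 clam1.
  have -> : (c * lam) *: u + (1 - c * lam) *: y = lam *: x + (1 - lam) *: y.
    rewrite !convE /u convE addrK scalerA mulrAC divff ?gt_eqF//.
    by rewrite mul1r.
  have [_ hM] := EM; have := hM x y c^-1 Ux Uy xyt ci0 ci1.
  rewrite -/u -(ler_pM2l clam0).
  have -> : c * lam * (h u + c^-1 * (1 - c^-1) * M) =
    c * lam * h u + lam * (1 - c^-1) * M by field; rewrite gt_eqF.
  have -> : c * lam * (c^-1 * h x + (1 - c^-1) * h y) =
    lam * h x + (c * lam - lam) * h y by field; rewrite gt_eqF.
  have : lam * ((1 - lam) * (1 - c / 2) * gap) <= lam * ((1 - c * lam) * gap).
    rewrite ler_pM2l//; apply: ler_wpM2r => //; nra.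
  have : c * lam * (1 - c * lam) * m + lam * (1 - c^-1) * M =
      lam * (1 - lam) * M + lam * ((1 - c * lam) * gap).
    by rewrite /gap; field; rewrite gt_eqF.
  clearbody gap M; lra.
have Mgap : M + (1 - c / 2) * gap <= M by apply: (ub_le_sup hE.2).
have gap_le0 : gap <= 0.
  have : 0 < 1 - c / 2 by lra.
  by move=> ?; nra.
apply: notc2m; have -> : c ^+ 2 * m = M; last exact: EM.
have : gap = 0 by lra.
move/eqP; rewrite subr_eq0 => /eqP cmM.
by rewrite expr2 -mulrA cmM mulrC divfK// gt_eqF.
Qed.

Lemma gauge_value_growth (s m : R) : 1 <= s -> gauge_value 1 m ->
  gauge_value s (s ^+ 2 * m).
Proof.
move=> s1 hm.
suff H : forall n (s : R), 1 <= s -> s <= (3 / 2) ^+ n ->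
    gauge_value s (s ^+ 2 * m).
  have [n sn] : exists n, s <= (3 / 2) ^+ n.
    have half_lt1 : `|(2 / 3 : R)| < 1 by rewrite ger0_norm ?divr_ge0//; lra.
    have s0 : 0 < s^-1 by rewrite invr_gt0; lra.
    have /cvgrPdist_lt/(_ _ s0)/filter_ex[n] := cvg_geometric 1 half_lt1.
    rewrite sub0r normrN /geometric /= mul1r ger0_norm ?exprn_ge0 ?divr_ge0//.
    move=> /ltW ns; exists n; rewrite -(invf_div 2) exprVn.
    by rewrite -[s in s <= _]invrK lef_pV2 ?posrE ?exprn_gt0 ?divr_gt0.
  exact: (H n).
elim=> [|n IH] {}s {}s1 sn.
  have -> : s = 1 by apply/eqP; rewrite eq_le s1 andbT; rewrite expr0 in sn.
  by rewrite expr1n mul1r.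
have [s_le|s_gt] := leP s (3 / 2).
  rewrite -[s in gauge_value s]mulr1; apply: gauge_value_dilate => //; lra.
have s1' : 1 <= s / (3 / 2) by rewrite ler_pdivlMr; lra.
have sn' : s / (3 / 2) <= (3 / 2) ^+ n.
  by rewrite ler_pdivrMr -?exprSr//; lra.
have := @gauge_value_dilate (3 / 2) _ _ _ _ (IH _ s1' sn').
have -> : 3 / 2 * (s / (3 / 2)) = s by field.
have -> : (3 / 2) ^+ 2 * ((s / (3 / 2)) ^+ 2 * m) = s ^+ 2 * m by field.
by apply; lra.
Qed.

(** When [x] is only in the domain, the gauge applies to a subsegment that lies
    in the zone, has two thirds of the length and contains the point with weight
    [lam] well inside; convexity handles the rest, and [3 / 16] is what is
    left of the modulus. *)
Lemma gauge_value_boundary x y (m lam : R) : edom b x -> U y ->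
  gauge_value (2 / 3 * `|x - y|) m -> 0 < lam -> lam < 1 ->
  h (lam *: x + (1 - lam) *: y) + lam * (1 - lam) * (3 / 16 * m)
    <= lam * h x + (1 - lam) * h y.
Proof.
move=> xb Uy [m0 hm] lam0 lam1.
have seg (s1 s2 : R) : s2 *: (x - y) + y - (s1 *: (x - y) + y) =
    (s2 - s1) *: (x - y).
  by rewrite opprD addrACA subrr addr0 -scalerBl.
have [lam_le|lam_gt] := leP lam 2^-1.
  pose u := (2 / 3 : R) *: x + (1 - 2 / 3 : R) *: y.
  have t0 : 0 <= 2 / 3 :> R by lra.
  have t1 : 2 / 3 < 1 :> R by lra.
  have Uu : U u by exact: (zone_segment b_bregman).
  have hu := zone_convex xb Uy t0 t1; rewrite -/u in hu.
  have uy : `|u - y| = 2 / 3 * `|x - y|.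
    by rewrite /u convE addrK normrZ ger0_norm.
  pose a := 3 / 2 * lam; have a0 : 0 < a by rewrite /a; lra.
  have a1 : a < 1 by rewrite /a; lra.
  have := hm u y a Uu Uy uy a0 a1.
  have -> : a *: u + (1 - a) *: y = lam *: x + (1 - lam) *: y.
    by rewrite !convE /u convE addrK scalerA; congr (_ *: _ + _); rewrite /a; field.
  set z := h (lam *: _ + _) => hz.
  have ahu := ler_wpM2l (ltW a0) hu.
  have am : lam * (1 - lam) * (3 / 16 * m) <= a * (1 - a) * m.
    rewrite mulrA; apply: ler_wpM2r => //; rewrite /a; nra.
  have aE : a * (2 / 3 * h x + (1 - 2 / 3) * h y) + (1 - a) * h y =
    lam * h x + (1 - lam) * h y by rewrite /a; field.
  lra.
pose s2 := (1 + lam) / 2; pose s1 := s2 - 2 / 3.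
have s20 : 0 <= s2 by rewrite /s2; lra.
have s21 : s2 < 1 by rewrite /s2; lra.
have s10 : 0 <= s1 by rewrite /s1 /s2; lra.
have s11 : s1 < 1 by rewrite /s1 /s2; lra.
pose z2 := s2 *: x + (1 - s2) *: y; pose z1 := s1 *: x + (1 - s1) *: y.
have Uz2 : U z2 by exact: (zone_segment b_bregman).
have Uz1 : U z1 by exact: (zone_segment b_bregman).
have hz2 := zone_convex xb Uy s20 s21; have hz1 := zone_convex xb Uy s10 s11.
rewrite -/z2 in hz2; rewrite -/z1 in hz1.
have z21 : `|z2 - z1| = 2 / 3 * `|x - y|.
  rewrite /z2 /z1 !convE seg /s1 subKr normrZ ger0_norm//; lra.
pose a := 3 / 4 * lam + 1 / 4; have a0 : 0 < a by rewrite /a; lra.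
have a1 : a < 1 by rewrite /a; lra.
have := hm z2 z1 a Uz2 Uz1 z21 a0 a1.
have -> : a *: z2 + (1 - a) *: z1 = lam *: x + (1 - lam) *: y.
  rewrite /z2 /z1 !convE seg scalerA addrA -scalerDl.
  by congr (_ *: _ + _); rewrite /a /s1 /s2; field.
set z := h (lam *: _ + _) => hz.
have ahz2 := ler_wpM2l (ltW a0) hz2.
have a10 : 0 <= 1 - a by lra.
have ahz1 := ler_wpM2l a10 hz1.
have am : lam * (1 - lam) * (3 / 16 * m) <= a * (1 - a) * m.
  rewrite mulrA; apply: ler_wpM2r => //; rewrite /a; nra.
have aE : a * (s2 * h x + (1 - s2) * h y) + (1 - a) * (s1 * h x + (1 - s1) * h y) =
  lam * h x + (1 - lam) * h y by rewrite /a /s1 /s2; field.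
lra.
Qed.

Lemma uniformly_convex_zone_at_infinity (C : set X) : C `<=` edom b ->
  uniformly_convex_on b U -> uniformly_convex_at_infinity b U C.
Proof.
move=> Cb [psi psiU]; have [[U0 _ _ _] psi_ge0 psi_gt0 _] := psiU.
(* Truncation keeps the given gauge finite at short distances. *)
pose mu t := fine (mine (psi t) 1%:E).
have mu_fin t : 0 <= t -> (mu t)%:E = mine (psi t) 1%:E.
  move=> t0; rewrite fineK// ge0_fin_numE ?gt_min ?ltry ?orbT//.
  by rewrite le_min psi_ge0//= lee_fin.
have mu_gt0 t : 0 < t -> 0 < mu t.
  by move=> t0; rewrite -lte_fin mu_fin ?ltW// lt_min psi_gt0//= lte_fin.
have mu_value t : 0 <= t -> gauge_value t (mu t).
  move=> t0; split; first by rewrite -lee_fin mu_fin// le_min psi_ge0//= lee_fin.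
  move=> x y lam Ux Uy xyt lam0 lam1.
  apply: (uniformly_convex_rel_real b_bregman psiU) => //.
  by rewrite xyt mu_fin// ge_min lexx.
pose Psi t := if t < 1 then mu t else t ^+ 2 * mu 1.
have Psi_value t : 0 <= t -> gauge_value t (Psi t).
  move=> t0; rewrite /Psi; case: (ltP t 1) => t1; first exact: mu_value.
  by apply: gauge_value_growth => //; exact: mu_value.
have Psi_gt0 t : 0 < t -> 0 < Psi t.
  move=> t0; rewrite /Psi; case: (ltP t 1) => _; first exact: mu_gt0.
  by rewrite mulr_gt0 ?exprn_gt0// mu_gt0.
move=> x Cx; exists 0 => A.
have AU : A = U by apply/seteqP; split=> y; [case|split].
rewrite AU; split=> //; exists (fun t => (3 / 16 * Psi (2 / 3 * t))%:E).
  split.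
  - split=> //; first by exists x.
      by move=> _ ->; exact: Cb.
    by move=> y; exact: (zone_edom b_bregman).
  - move=> t t0; have t0' : 0 <= 2 / 3 * t by lra.
    by rewrite lee_fin; have [H _] := Psi_value _ t0'; lra.
  - move=> t t0; have t0' : 0 < 2 / 3 * t by lra.
    by rewrite lte_fin; have := Psi_gt0 _ t0'; lra.
  - move=> t _ y t0 t1 -> Uy; have xb := Cb _ Cx.
    have yb := zone_edom b_bregman Uy.
    rewrite (edom_fine b_bregman (edom_segment b_bregman xb yb t0 t1)).
    rewrite (edom_fine b_bregman xb) (edom_fine b_bregman yb).
    rewrite -!EFinM -!EFinD lee_fin; apply: gauge_value_boundary => //.
    by apply: Psi_value; rewrite mulr_ge0// divr_ge0.
have m0 := mu_gt0 _ ltr01.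
apply/cvgeyPge => a; near=> t.
have t1 : 3 / 2 <= t by near: t; apply: nbhs_pinfty_ge; exact: num_real.
have ta : 12 * a / mu 1 <= t by near: t; apply: nbhs_pinfty_ge; exact: num_real.
rewrite lee_fin /Psi ltNge; have -> /= : 1 <= 2 / 3 * t by lra.
move: ta; rewrite ler_pdivrMr// => ta.
have : mu 1 * t <= mu 1 * (t * t) by rewrite ler_pM2l//; nra.
by rewrite exprMn expr2; lra.
Unshelve. all: by end_near. Qed.

End uniform_convexity_growth.

(** * Convergence of the proximal gradient iterates *)

Section convergence.
Context {R : realType} {X : completeNormedModType R}.
Hypothesis X_reflexive : reflexive_space X.
Variables (b : X -> \bar R) (U : set X) (C : set X).
Variables (f : X -> R) (g : X -> \bar R).
Hypothesis b_bregman : semi_bregman b U.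
Hypothesis C_feasible : feasible_set b U C.
Hypothesis f_smooth : smooth_part b U C f.
Hypothesis g_nonsmooth : nonsmooth_part C g.
Variables (S : nat -> set X) (mu : nat -> R).
Hypothesis A1 : minimizers C f g !=set0 /\ minimizers C f g `<=` U.
Hypothesis A2 : telescopic b U C g S mu.
Hypothesis A3 : forall k, (1 <= k)%N -> lipschitz_grad f (S k `&` U).
Hypothesis A4 : forall (L : R) (k : nat) (y : X), 0 < L -> (1 <= k)%N ->
  (S k `&` U) y -> (S k `&` U) (prox b U f g L (mu k) (S k) y).
Variables (x : nat -> X) (L : nat -> R).
Hypothesis algorithm : lipschitz_step_rule b U f g S mu x L \/
  exists eta : R, backtracking_step_rule b U C f g eta S mu x L.

Let D := bregman_div b.
Let Fr (z : X) : R := f z + fine (g z).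

Lemma telescopic_mono j k : (1 <= j)%N -> (j <= k)%N -> S j `<=` S k.
Proof.
have [Sk _ _ _ _] := A2; move=> j1; elim: k => [|k IH]; first by case: j j1.
rewrite leq_eqVlt => /predU1P[->//|]; rewrite ltnS => jk.
by have [_ _ _ [Skk _]] := Sk k (leq_trans j1 jk); apply: subset_trans (IH jk) Skk.
Qed.

Lemma telescopic_sub k : (1 <= k)%N -> S k `<=` C.
Proof.
have [_ _ _ <- _] := A2; move=> k1; exact: bigcup_sup.
Qed.

Lemma telescopic_proper k : (1 <= k)%N -> exists2 z, S k z & (g z < +oo)%E.
Proof.
have [_ _ _ _ [_ [z S1z gz]]] := A2; move=> k1.
by exists z => //; exact: telescopic_mono S1z.
Qed.

Lemma telescopic_segment k : (1 <= k)%N -> segment_closed (S k).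
Proof. by have [Sk _ _ _ _] := A2; move=> /Sk[_ /convex_set_segment]. Qed.

Lemma telescopic_closed k : (1 <= k)%N -> closed (S k).
Proof. by have [Sk _ _ _ _] := A2; move=> /Sk[]. Qed.

Lemma telescopic_strong k : (1 <= k)%N -> strongly_convex_on b (S k) (mu k).
Proof. by have [_ Sk _ _ _] := A2; exact: Sk. Qed.

Lemma mu_gt0 k : (1 <= k)%N -> 0 < mu k.
Proof. by move=> /telescopic_strong[]. Qed.

Lemma step_size_gt0 k : (1 <= k)%N -> 0 < L k.
Proof.
case: algorithm => [[L1 _ _ Lstep]|[eta [eta1 L1 _ _ Lstep]]].
  elim: k => // -[|k] IH _ //.
  have [+ _] := Lstep k.+2 isT; apply: lt_le_trans.
  by rewrite lt_max IH.
elim: k => // -[|k] IH _ //.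
have [i [_ _ -> _]] := Lstep k.+2 isT.
by rewrite mulr_gt0 ?IH// exprn_gt0//; lra.
Qed.

Lemma iterate_prox k : (2 <= k)%N -> x k = prox b U f g (L k) (mu k) (S k) (x k.-1).
Proof.
case: algorithm => [[_ _ _ Lstep]|[eta [_ _ _ _ Lstep]]] /Lstep; first by case.
by case=> i [].
Qed.

Lemma iterate_mem k : (1 <= k)%N -> (S k `&` U) (x k).
Proof.
elim: k => // -[_ _|k IH _]; first by case: algorithm => [[]|[eta []]].
rewrite iterate_prox//=; apply: A4 => //; first exact: step_size_gt0.
have [Sx Ux] := IH isT; split=> //; exact: telescopic_mono Sx.
Qed.

Lemma iterate_prev_mem k : (2 <= k)%N -> (S k `&` U) (x k.-1).
Proof.
case: k => // k k1; have [Sx Ux] := iterate_mem k1; split=> //.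
exact: telescopic_mono Sx.
Qed.

Lemma iterate_feasible k : (1 <= k)%N -> C (x k).
Proof. by move=> k1; have [Sx _] := iterate_mem k1; exact: telescopic_sub Sx. Qed.

Lemma iterate_zone k : (1 <= k)%N -> U (x k).
Proof. by move=> k1; have [] := iterate_mem k1. Qed.

Lemma iterate_lty k : (2 <= k)%N -> (g (x k) < +oo)%E.
Proof.
move=> k2; have k1 : (1 <= k)%N by exact: ltnW.
have [Sx Ux] := iterate_prev_mem k2; rewrite iterate_prox//.
exact: (prox_lty b_bregman C_feasible f_smooth g_nonsmooth
  (telescopic_sub k1) (telescopic_closed k1) (telescopic_segment k1)
  (telescopic_proper k1) (telescopic_strong k1) (step_size_gt0 k1) Ux).
Qed.

Lemma iterate_sufficient_decrease k : (2 <= k)%N ->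
  (objective C f g (x k) <= prox_model b U f g (L k) (mu k) (x k) (x k.-1))%E.
Proof.
move=> k2; have k1 : (1 <= k)%N by exact: ltnW.
have [Sx Ux] := iterate_prev_mem k2.
have [_ Up] := iterate_mem k1; rewrite iterate_prox// in Up *.
case: algorithm => [[_ _ _ /(_ k k2)[]]|[eta [_ _ _ _ /(_ k k2)]]].
  rewrite ge_max => /andP[_ lipL] _.
  exact: (lipschitz_sufficient_decrease b_bregman C_feasible f_smooth
    g_nonsmooth (telescopic_sub k1) (telescopic_closed k1)
    (telescopic_segment k1) (telescopic_proper k1) (telescopic_strong k1)
    (step_size_gt0 k1) Ux (A3 k1) lipL Sx Up).
by move=> [i [test _ -> _]].
Qed.

Lemma iterate_estimate k z : (2 <= k)%N -> S k z -> (g z < +oo)%E ->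
  Fr (x k) - Fr z <= L k / mu k * (D z (x k.-1) - D z (x k)).
Proof.
move=> k2 Sz gz; have k1 : (1 <= k)%N by exact: ltnW.
have [Sx Ux] := iterate_prev_mem k2.
have [_ Up] := iterate_mem k1.
have := iterate_sufficient_decrease k2; rewrite iterate_prox// in Up * => dec.
exact: (prox_step_estimate b_bregman C_feasible f_smooth
  g_nonsmooth (telescopic_sub k1) (telescopic_closed k1)
  (telescopic_segment k1) (telescopic_proper k1) (telescopic_strong k1)
  (step_size_gt0 k1) Ux (telescopic_sub k1 Sx) Up Sz gz dec).
Qed.

Lemma objective_nonincreasing k : (2 <= k)%N -> Fr (x k.+1) <= Fr (x k).
Proof.
move=> k2; have k1 : (1 <= k)%N by exact: ltnW.
have [Sx Ux] := @iterate_prev_mem k.+1 k1.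
have := @iterate_estimate k.+1 _ k1 Sx (iterate_lty k2).
rewrite /D (bregman_div_refl b_bregman Ux) sub0r => H.
have c0 : 0 <= L k.+1 / mu k.+1 by rewrite divr_ge0 ?ltW ?step_size_gt0 ?mu_gt0.
have d0 := bregman_div_ge0 b_bregman (zone_edom b_bregman Ux) (@iterate_zone k.+1 isT).
by rewrite /= in H d0; have := mulr_ge0 c0 d0; lra.
Qed.

Lemma objective_infty z : C z -> g z = +oo%E -> objective C f g z = +oo%E.
Proof. by move=> Cz gz; rewrite /objective mem_set// gz. Qed.

Lemma minimizer_lty z : minimizers C f g z -> (g z < +oo)%E.
Proof.
move=> [Cz Fz]; rewrite ltey; apply/eqP => gz.
have [_ [_ [w Cw gw]] _] := g_nonsmooth.
have := ereal_inf_lbound (imageP (objective C f g) Cw).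
rewrite -Fz objective_infty// (objectiveE f g_nonsmooth Cw gw).
by rewrite leye_eq.
Qed.

Lemma minimizer_le z w : minimizers C f g z -> C w -> (g w < +oo)%E ->
  Fr z <= Fr w.
Proof.
move=> zmin Cw gw; have gz := minimizer_lty zmin; have [Cz Fz] := zmin.
have := ereal_inf_lbound (imageP (objective C f g) Cw).
by rewrite -Fz !(objectiveE f g_nonsmooth)// lee_fin.
Qed.

Lemma minimizer_stage z : minimizers C f g z ->
  exists2 k0, (2 <= k0)%N & forall k, (k0 <= k)%N -> S k z.
Proof.
have [_ _ _ SC _] := A2; move=> [Cz _]; move: Cz; rewrite -SC => -[k /= k1 Sz].
exists (maxn 2 k); first exact: leq_maxl.
by move=> j; rewrite geq_max => /andP[_ kj]; exact: telescopic_mono Sz.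
Qed.

(** Fejer monotonicity: the left-hand side of [iterate_estimate] is nonnegative
    at a minimizer. *)
Lemma divergence_nonincreasing z k : minimizers C f g z -> (2 <= k)%N ->
  S k z -> D z (x k) <= D z (x k.-1).
Proof.
move=> zmin k2 Sz; have k1 : (1 <= k)%N by exact: ltnW.
have := iterate_estimate k2 Sz (minimizer_lty zmin).
have := minimizer_le zmin (iterate_feasible k1) (iterate_lty k2).
have : 0 < L k / mu k by rewrite divr_gt0 ?step_size_gt0 ?mu_gt0.
move=> c0 F0 H; have : 0 <= L k / mu k * (D z (x k.-1) - D z (x k)) by lra.
by rewrite pmulr_rge0// subr_ge0.
Qed.

Lemma divergence_iterate_ge0 z k : C z -> (1 <= k)%N -> 0 <= D z (x k).
Proof.
move=> Cz k1; apply: (bregman_div_ge0 b_bregman).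
  exact: (feasible_edom C_feasible).
exact: iterate_zone.
Qed.

Section rate.
Variable tau : nat -> R.
Hypothesis tau_gt0 : forall k, (1 <= k)%N -> 0 < tau k.
Hypothesis tau_nondecreasing : forall k, (1 <= k)%N -> tau k <= tau k.+1.
Hypothesis L_le_tau : forall k, (1 <= k)%N -> L k <= tau k.

(** The estimates for successive steps telescope, since the weights
    [mu k / tau k] are nonincreasing and so is the objective. *)
Lemma weighted_gap_bound z k0 n : minimizers C f g z -> (2 <= k0)%N ->
  (forall k, (k0 <= k)%N -> S k z) ->
  n%:R * (mu (k0 + n) / tau (k0 + n)) * (Fr (x (k0 + n)) - Fr z)
    <= D z (x k0) - D z (x (k0 + n)).
Proof.
move=> zmin k02 Sz; elim: n => [|n IH].
  by rewrite !mul0r addn0 subrr.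
rewrite addnS; set m := (k0 + n)%N in IH *.
have m2 : (2 <= m)%N by exact: leq_trans k02 (leq_addr _ _).
have m1 : (1 <= m)%N by exact: ltnW.
have Sm1 : S m.+1 z by apply: Sz; rewrite -addnS leq_addr.
have est := @iterate_estimate m.+1 _ m1 Sm1 (minimizer_lty zmin).
have e0 := minimizer_le zmin (@iterate_feasible m.+1 isT) (@iterate_lty m.+1 m1).
have de := objective_nonincreasing m2.
rewrite /= in est.
have muS := @mu_gt0 m.+1 isT; have LS := @step_size_gt0 m.+1 isT.
have w1 : mu m.+1 / tau m.+1 * (Fr (x m.+1) - Fr z) <= D z (x m) - D z (x m.+1).
  apply: (@le_trans _ _ (mu m.+1 / L m.+1 * (Fr (x m.+1) - Fr z))).
    apply: ler_wpM2r; first by rewrite subr_ge0.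
    by rewrite ler_pM2l// lef_pV2 ?posrE ?tau_gt0// L_le_tau.
  by rewrite -ler_pdivlMl ?divr_gt0// invf_div.
have w2 : mu m.+1 / tau m.+1 <= mu m / tau m.
  apply: ler_pM => //; [exact: ltW|by rewrite invr_ge0 ltW// tau_gt0| |].
    by have [_ _ H _ _] := A2; exact: H.
  by rewrite lef_pV2 ?posrE ?tau_gt0// tau_nondecreasing.
have w0 : 0 <= mu m.+1 / tau m.+1 by rewrite divr_ge0// ltW// tau_gt0.
have : n%:R * (mu m.+1 / tau m.+1) * (Fr (x m.+1) - Fr z) <=
    n%:R * (mu m / tau m) * (Fr (x m) - Fr z).
  apply: ler_pM; first by rewrite mulr_ge0.
  - by rewrite subr_ge0.
  - by rewrite ler_wpM2l.
  - by rewrite lerB.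
by rewrite -natr1; lra.
Qed.

Lemma gap_bound z k0 k : minimizers C f g z -> (2 <= k0)%N ->
  (forall k, (k0 <= k)%N -> S k z) -> (k0 < k)%N ->
  Fr (x k) - Fr z <= tau k / ((k - k0)%:R * mu k) * D z (x k0).
Proof.
move=> zmin k02 Sz k0k.
have k1 : (1 <= k)%N by rewrite (leq_trans _ k0k).
have := weighted_gap_bound (k - k0) zmin k02 Sz; rewrite subnKC 1?ltnW//.
have n0 : 0 < (k - k0)%:R :> R by rewrite ltr0n subn_gt0.
have muk := mu_gt0 k1; have tauk := tau_gt0 k1.
have := divergence_iterate_ge0 zmin.1 k1 => d0 H.
have {}H : (k - k0)%:R * (mu k / tau k) * (Fr (x k) - Fr z) <= D z (x k0) by lra.
rewrite -ler_pdivrMl ?divr_gt0 ?mulr_gt0//; apply: le_trans H.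
by rewrite invf_div mulrA.
Qed.

Hypothesis rate_to_0 : tau k / (k%:R * mu k) @[k --> \oo] --> (0 : R).

Lemma objective_real_cvg z : minimizers C f g z -> Fr (x k) @[k --> \oo] --> Fr z.
Proof.
move=> zmin; have [k0 k02 Sz] := minimizer_stage zmin.
apply/cvgrPdist_lt => e e0.
have k01 : (1 <= k0)%N by exact: ltnW.
have d0 := divergence_iterate_ge0 zmin.1 k01.
have d1 : 0 < 2 * D z (x k0) + 1 by lra.
have /cvgrPdist_lt/(_ _ (divr_gt0 e0 d1)) rate := rate_to_0.
near=> k.
have k2k0 : (2 * k0 <= k)%N by near: k; exists (2 * k0)%N.
have k0k : (k0 < k)%N by apply: leq_trans k2k0; rewrite mul2n -addnn -addn1 leq_add2l.
have k2 : (2 <= k)%N by apply: leq_trans k02 (ltnW k0k).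
have k1 : (1 <= k)%N by exact: ltnW.
have Fk := minimizer_le zmin (iterate_feasible k1) (iterate_lty k2).
rewrite distrC ger0_norm ?subr_ge0//.
apply: le_lt_trans (gap_bound zmin k02 Sz k0k) _.
have muk := mu_gt0 k1; have tauk := tau_gt0 k1.
have rk : tau k / (k%:R * mu k) < e / (2 * D z (x k0) + 1).
  apply: le_lt_trans (ler_norm _) _; rewrite -normrN -sub0r.
  by near: k; exact: rate.
have kR : 0 < k%:R :> R by rewrite ltr0n.
have nR : 0 < (k - k0)%:R :> R by rewrite ltr0n subn_gt0.
(* [k >= 2 * k0] gives [k - k0 >= k / 2]. *)
have half : tau k / ((k - k0)%:R * mu k) <= 2 * (tau k / (k%:R * mu k)).
  have -> : 2 * (tau k / (k%:R * mu k)) = tau k / (k%:R / 2 * mu k).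
    by field; rewrite !gt_eqF.
  rewrite ler_pM2l// lef_pV2 ?posrE ?mulr_gt0 ?divr_gt0//.
  rewrite ler_pM2r// ler_pdivrMr// natrB 1?ltnW//.
  have : (2 * k0)%:R <= k%:R :> R by rewrite ler_nat.
  by rewrite natrM; lra.
apply: (@le_lt_trans _ _ (2 * (tau k / (k%:R * mu k)) * D z (x k0))).
  exact: ler_wpM2r.
move: rk; rewrite ltr_pdivlMr//.
have : 0 <= tau k / (k%:R * mu k) by rewrite divr_ge0 ?mulr_ge0// ltW.
by set r := tau k / _; lra.
Unshelve. all: by end_near. Qed.

Lemma objective_cvg :
  objective C f g (x k) @[k --> \oo] --> ereal_inf [set objective C f g z | z in C].
Proof.
have [[z zmin] _] := A1; have [Cz Fz] := zmin; rewrite -Fz.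
rewrite (objectiveE f g_nonsmooth Cz (minimizer_lty zmin)).
apply: (@cvg_trans _ ((Fr (x k))%:E @[k --> \oo])); last first.
  by apply: cvg_EFin; [exact: nearW|exact: objective_real_cvg zmin].
apply: near_eq_cvg; near=> k; have k2 : (2 <= k)%N by near: k; exists 2%N.
by rewrite (objectiveE f g_nonsmooth)//; [exact/iterate_feasible/ltnW|exact: iterate_lty].
Unshelve. all: by end_near. Qed.

Lemma sublevel_closed (a : R) : closed [set w | C w /\ (objective C f g w <= a%:E)%E].
Proof.
have [_ [_ Ccl] _ _ _] := C_feasible; have [_ _ lscf] := f_smooth.
have [_ _ lscg] := g_nonsmooth.
have := @lsc_within_sublevel_closed _ _ C (fun w => ((f w)%:E + g w)%E) a Ccl.
have -> : [set w | C w /\ ((f w)%:E + g w <= a%:E)%E] =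
    [set w | C w /\ (objective C f g w <= a%:E)%E].
  apply/seteqP; split=> w /= [Cw]; rewrite /objective mem_set//.
apply; apply: lsc_withinD.
- by move=> w _; rewrite ltNyr.
- by move=> w; exact: (nonsmooth_gtNy g_nonsmooth).
- exact: (lsc_on_within lscf).
- exact: lsc_on_within.
Qed.

Lemma sublevel_segment (a : R) :
  segment_closed [set w | C w /\ (objective C f g w <= a%:E)%E].
Proof.
have lty w : C w -> (objective C f g w <= a%:E)%E -> (g w < +oo)%E.
  move=> Cw wa; rewrite ltey; apply/eqP => gw; move: wa.
  by rewrite objective_infty.
move=> u v t [Cu ua] [Cv va] t0 t1.
have gu := lty u Cu ua; have gv := lty v Cv va.
have Cw := feasible_segment C_feasible Cu Cv t0 t1.
have gw := nonsmooth_convex_lty g_nonsmooth Cu Cv t0 t1 gu gv.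
split=> //; move: ua va; rewrite !(objectiveE f g_nonsmooth)// !lee_fin.
have := nonsmooth_convex C_feasible g_nonsmooth Cu Cv t0 t1 gu gv.
have := smooth_convex C_feasible f_smooth Cu Cv t0 t1.
by set w := _ + _; nra.
Qed.

(** Sublevel sets of the objective are weakly closed by Mazur's theorem. *)
Lemma weak_limit_minimizer (s : nat -> nat) w :
  s @ \oo --> \oo -> weak_cvg (x \o s) w -> minimizers C f g w.
Proof.
move=> s_oo xsw; have [[z zmin] _] := A1; have [Cz Fz] := zmin.
have Fzr := objectiveE f g_nonsmooth Cz (minimizer_lty zmin).
have wa (a : R) : Fr z < a -> C w /\ (objective C f g w <= a%:E)%E.
  move=> za; apply: (weak_cvg_closed_convex
    (K := [set v | C v /\ (objective C f g v <= a%:E)%E]) _ _ _ xsw).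
  - exact: sublevel_closed.
  - exact: sublevel_segment.
  - apply: (s_oo [set k | C (x k) /\ (objective C f g (x k) <= a%:E)%E]).
    near=> k; have k2 : (2 <= k)%N by near: k; exists 2%N.
    have Cx := iterate_feasible (ltnW k2); split=> //.
    rewrite (objectiveE f g_nonsmooth Cx (iterate_lty k2)) lee_fin ltW//.
    by near: k; exact: cvgr_lt (objective_real_cvg zmin) _ za.
have Cw : C w by have [] := wa (Fr z + 1); first by rewrite ltrDl.
split=> //; apply/eqP; rewrite eq_le; apply/andP; split; last first.
  exact: (ereal_inf_lbound (imageP (objective C f g) Cw)).
rewrite -Fz Fzr; apply/lee_addgt0Pr => e e0; rewrite -EFinD.
by have [] := wa (Fr z + e); first by rewrite ltrDl.
Unshelve. all: by end_near. Qed.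

Lemma divergence_cvg z : minimizers C f g z -> cvgn (fun k => D z (x k)).
Proof.
move=> zmin; have [k0 k02 Sz] := minimizer_stage zmin.
have : cvgn (fun n => D z (x (n + k0)%N)).
  apply: nonincreasing_is_cvgn.
    apply/nonincreasing_seqP => n.
    have := @divergence_nonincreasing z (n + k0).+1 zmin; rewrite /=; apply.
      by rewrite ltnS (leq_trans (ltnW k02))// leq_addl.
    by apply: Sz; rewrite leqW// leq_addl.
  exists 0 => _ [n _ <-]; apply: divergence_iterate_ge0; first exact: zmin.1.
  by rewrite (leq_trans (ltnW k02))// leq_addl.
move=> /cvg_ex[l xl]; apply/cvg_ex; exists l.
by rewrite -(cvg_shiftn k0).
Qed.

(** If [w1] and [w2] are two weak limit points, the limiting difference
    property evaluates the limit of [D w1 (x k) - D w2 (x k)] both as [D w1 w2]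
    and as [- D w2 w1], and divergences are nonnegative. *)
Lemma weak_limits_unique (s1 s2 : nat -> nat) w1 w2 : limiting_difference b U ->
  s1 @ \oo --> \oo -> s2 @ \oo --> \oo ->
  (forall j, (1 <= s1 j)%N) -> (forall j, (1 <= s2 j)%N) ->
  weak_cvg (x \o s1) w1 -> weak_cvg (x \o s2) w2 -> w1 = w2.
Proof.
move=> limdiff s1oo s2oo s1_ge1 s2_ge1 xw1 xw2.
have m1 := weak_limit_minimizer s1oo xw1; have m2 := weak_limit_minimizer s2oo xw2.
have /cvg_ex[a1 a1P] := divergence_cvg m1; have /cvg_ex[a2 a2P] := divergence_cvg m2.
have Ub z : minimizers C f g z -> U z by move=> zm; exact: A1.2.
have diff z w a c (s : nat -> nat) : minimizers C f g z -> minimizers C f g w ->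
    s @ \oo --> \oo -> (forall j, (1 <= s j)%N) -> weak_cvg (x \o s) w ->
    D z (x k) @[k --> \oo] --> a -> D w (x k) @[k --> \oo] --> c ->
    D z w = a - c.
  move=> zm wm s_oo s_ge1 xsw za wc.
  have zb := zone_edom b_bregman (Ub z zm); have wb := zone_edom b_bregman (Ub w wm).
  have Uxs i : U ((x \o s) i) by exact: iterate_zone.
  have := limdiff z (x \o s) w zb Uxs (Ub w wm) xsw.
  rewrite (divergenceE b_bregman zb (Ub w wm)) => /fine_cvgP[_].
  have -> : fine \o (fun i => divergence b U z ((x \o s) i) -
      divergence b U w ((x \o s) i))%E = (fun k => D z (x k) - D w (x k)) \o s.
    apply/funext => i /=.
    by rewrite (divergenceE b_bregman zb (Uxs i)) (divergenceE b_bregman wb (Uxs i)).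
  move=> H; apply: cvg_unique H _ => //.
  by apply: cvg_comp s_oo _; exact: cvgB.
have d12 := diff w1 w2 a1 a2 s2 m1 m2 s2oo s2_ge1 xw2 a1P a2P.
have d21 := diff w2 w1 a2 a1 s1 m2 m1 s1oo s1_ge1 xw1 a2P a1P.
have b1 := zone_edom b_bregman (Ub _ m1); have b2 := zone_edom b_bregman (Ub _ m2).
have := bregman_div_ge0 b_bregman b1 (Ub _ m2).
have := bregman_div_ge0 b_bregman b2 (Ub _ m1).
rewrite -/D => p21 p12.
by apply: (bregman_div_eq0 b_bregman b1 (Ub _ m2)); rewrite -/D; lra.
Qed.

Theorem weak_convergence : limiting_difference b U ->
  (forall z, C z -> forall a, exists M, forall y, U y -> D z y <= a -> `|y| <= M) ->
  exists2 z, minimizers C f g z & weak_cvg x z.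
Proof.
move=> limdiff level_bounded; have [[z0 z0min] _] := A1.
have [k0 k02 Sz0] := minimizer_stage z0min.
have [M HM] := level_bounded _ z0min.1 (D z0 (x k0)).
have Fejer n : D z0 (x (n + k0)%N) <= D z0 (x k0).
  elim: n => [|n IH] //; apply: le_trans IH; rewrite addSn.
  have := @divergence_nonincreasing z0 (n + k0).+1 z0min; apply.
    by rewrite ltnS (leq_trans (ltnW k02))// leq_addl.
  by apply: Sz0; rewrite leqW// leq_addl.
have k0_ge1 n : (1 <= n + k0)%N by rewrite (leq_trans (ltnW k02))// leq_addl.
pose y n := x (n + k0)%N.
have yM n : `|y n| <= M by apply: HM; [exact: iterate_zone (k0_ge1 n)|exact: Fejer].
have shift_oo (s : nat -> nat) : (forall j, (s j < s j.+1)%N) ->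
    (fun j => s j + k0)%N @ \oo --> \oo.
  move=> sS A [N _ NA]; exists N => // j /= Nj; apply: NA => /=.
  apply: leq_trans (leq_addr _ _); apply: leq_trans Nj _.
  exact: strictly_increasing_ge.
have [s [sS [z yz]]] := reflexive_bounded_subsequence X_reflexive yM.
have zmin : minimizers C f g z by apply: weak_limit_minimizer (shift_oo s sS) yz.
exists z => // l dl; rewrite -(cvg_shiftn k0); move: l dl.
apply: (weak_cvg_unique_subsequential_limit X_reflexive yM) => s' w s'S yw.
exact: (weak_limits_unique limdiff (shift_oo s' s'S) (shift_oo s sS)
  (fun j => k0_ge1 (s' j)) (fun j => k0_ge1 (s j)) yw yz).
Qed.

End rate.

End convergence.

(** * Sufficient conditions on the Bregman function *)

Section sufficient_conditions.
Context {R : realType} {X : completeNormedModType R}.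
Variables (b : X -> \bar R) (U : set X).
Hypothesis b_bregman : semi_bregman b U.

(** In the difference of divergences the gradients at [y_ i] only act on the
    fixed vector [x - y]. *)
Lemma grad_continuous_limiting_difference :
  grad_weak_to_weakstar_continuous b U -> limiting_difference b U.
Proof.
move=> gradc x y_ y xb Uy_ Uy yw; have yb := zone_edom b_bregman Uy.
rewrite (divergenceE b_bregman xb Uy).
have -> : (fun i => divergence b U x (y_ i) - divergence b U y (y_ i))%E =
    (fun i => (fine (b x) - fine (b y) - egrad b (y_ i) (x - y))%:E).
  apply/funext => i.
  rewrite (divergenceE b_bregman xb (Uy_ i)) (divergenceE b_bregman yb (Uy_ i)).
  rewrite -EFinB; congr EFin; rewrite /bregman_div.
  have dl := zone_dual b_bregman (Uy_ i).
  by rewrite !(dualB _ _ dl); ring.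
apply: cvg_EFin; first exact: nearW.
by apply: cvgB; [exact: cvg_cst|exact: gradc].
Qed.

Lemma bounded_set_ex (A : set X) : bounded_set A ->
  exists M, forall y, A y -> `|y| <= M.
Proof.
move=> [M [_ hM]]; exists (M + 1) => y Ay; apply: hM => //.
by rewrite ltrDl.
Qed.

Lemma uniformly_convex_at_infinity_level_bounded (C : set X) z (a : R) :
  uniformly_convex_at_infinity b U C -> C z ->
  exists M, forall y, U y -> bregman_div b z y <= a -> `|y| <= M.
Proof.
move=> ucC Cz; have [r [r0 _ [psi psiA /cvgeyPge/(_ (a + 1))[T [_ hT]]]]] := ucC z Cz.
exists (Num.max r (`|z| + `|T|)) => y Uy zya; rewrite le_max.
have [ry|yr] := leP r `|y|; last by rewrite ltW.
apply/orP; right.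
suff zyT : `|z - y| <= T.
  have := ler_normB z (z - y); rewrite subKr.
  by have := ler_norm T; lra.
rewrite leNgt; apply/negP => /hT psi_big.
have [[_ _ zb _] _ _ _] := psiA.
suff : a + 1 <= bregman_div b z y by lra.
apply: (bregman_div_ge b_bregman) => //; first exact: zb.
by move=> t t0 t1; exact: (uniformly_convex_rel_real b_bregman psiA).
Qed.

End sufficient_conditions.

Unset Implicit Arguments.

Theorem theorem6p1 (R : realType) (X : completeNormedModType R)
    (X_neq0 : exists v : X, v <> 0) (X_reflexive : reflexive_space X)
    (b : X -> \bar R) (U : set X) (b_bregman : semi_bregman b U)
    (C : set X) (C_feasible : feasible_set b U C)
    (f : X -> R) (f_smooth : smooth_part b U C f)
    (g : X -> \bar R) (g_nonsmooth : nonsmooth_part C g)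
    (S : nat -> set X) (mu : nat -> R)
    (A1 : minimizers C f g !=set0 /\ minimizers C f g `<=` U)
    (A2 : telescopic b U C g S mu)
    (A3 : forall k, (1 <= k)%N -> lipschitz_grad f (S k `&` U))
    (A4 : forall (L : R) (k : nat) (y : X), 0 < L -> (1 <= k)%N ->
       (S k `&` U) y -> (S k `&` U) (prox b U f g L (mu k) (S k) y))
    (x : nat -> X) (L : nat -> R)
    (algorithm : lipschitz_step_rule b U f g S mu x L \/
       exists eta : R, backtracking_step_rule b U C f g eta S mu x L)
    (tau : nat -> R)
    (tau_gt0 : forall k, (1 <= k)%N -> 0 < tau k)
    (tau_nondecreasing : forall k, (1 <= k)%N -> tau k <= tau k.+1)
    (L_le_tau : forall k, (1 <= k)%N -> L k <= tau k) :
  let F := objective C f g in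
  let B := divergence b U in
  let rate_to_0 := tau k / (k%:R * mu k) @[k --> \oo] --> (0 : R) in
  [/\
      forall xmin, minimizers C f g xmin ->
        exists k0 : nat,
          [/\ (1 <= k0)%N, F (x 1%N) = +oo%E -> (2 <= k0)%N
            & forall k, (k0 <= k)%N ->
                (F (x k.+1) - F xmin <=
                 (tau k.+1 / ((k.+1 - k0)%:R * mu k.+1))%:E
                   * B xmin (x k0))%E],
      rate_to_0 ->
        F (x k) @[k --> \oo] --> ereal_inf [set F z | z in C],
      rate_to_0 -> limiting_difference b U -> first_level_sets_bounded b U ->
        exists2 z, minimizers C f g z & weak_cvg x z
    &
      (rate_to_0 -> grad_weak_to_weakstar_continuous b U ->
         bounded_set U \/ uniformly_convex_at_infinity b U C ->
         exists2 z, minimizers C f g z & weak_cvg x z) /\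
      (uniformly_convex_on b U -> uniformly_convex_at_infinity b U C)].
Proof.
move=> F B rate_to_0.
have minF z : minimizers C f g z -> F z = (f z + fine (g z))%:E.
  move=> zmin; apply: (objectiveE f g_nonsmooth); first exact: zmin.1.
  exact: minimizer_lty zmin.
have weak_limit : rate_to_0 -> limiting_difference b U ->
    (forall z, C z -> forall a, exists M, forall y, U y ->
      bregman_div b z y <= a -> `|y| <= M) ->
    exists2 z, minimizers C f g z & weak_cvg x z.
  by move=> rate; apply: (weak_convergence X_reflexive b_bregman C_feasible
    f_smooth g_nonsmooth A1 A2 A3 A4 algorithm tau_gt0 tau_nondecreasing
    L_le_tau rate).
split.
- move=> xmin xminP; have [k0 k02 Sxmin] := minimizer_stage A2 xminP.
  (* A stage [k0 >= 2] serves whether or not [F (x 1)] is finite. *)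
  exists k0; split=> [|_|k k0k]; [exact: ltnW|exact: k02|].
  have k2 : (2 <= k.+1)%N by rewrite ltnS (leq_trans (ltnW k02)).
  have := gap_bound b_bregman C_feasible f_smooth g_nonsmooth A2 A3 A4 algorithm
    tau_gt0 tau_nondecreasing L_le_tau xminP k02 Sxmin (k := k.+1) k0k.
  rewrite /F (objectiveE f g_nonsmooth); first last.
  + exact: (iterate_lty b_bregman C_feasible f_smooth g_nonsmooth A2 A4 algorithm).
  + exact: (iterate_feasible A2 A4 algorithm).
  rewrite -/F minF// /B (divergenceE b_bregman); first last.
  + exact/(iterate_zone A2 A4 algorithm)/ltnW.
  + exact: (feasible_edom C_feasible xminP.1).
  by rewrite -EFinB -EFinM lee_fin.
- move=> rate; exact: (objective_cvg b_bregman C_feasible f_smooth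
    g_nonsmooth A1 A2 A3 A4 algorithm tau_gt0 tau_nondecreasing L_le_tau rate).
- move=> rate limdiff bounded; apply: weak_limit => // z Cz a.
  have zb := feasible_edom C_feasible Cz.
  have a0 : 0 <= Num.max a 0 by rewrite le_max lexx orbT.
  have [M HM] := bounded_set_ex (bounded z (Num.max a 0) zb a0).
  exists M => y Uy zya; apply: HM; split=> //.
  by rewrite (divergenceE b_bregman zb Uy) lee_fin le_max zya.
- split.
    move=> rate gradc bounded; apply: weak_limit => //.
      exact: grad_continuous_limiting_difference.
    move=> z Cz a; case: bounded => [/bounded_set_ex[M HM]|ucC].
      by exists M => y Uy _; exact: HM.
    exact: (uniformly_convex_at_infinity_level_bounded b_bregman a ucC Cz).
  apply: (uniformly_convex_zone_at_infinity b_bregman).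
  by move=> z; exact: (feasible_edom C_feasible).
Qed.
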